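(* As $n\to\infty$, $$\mathrm{ou}^*(n) \sim \frac{e^{\pi\sqrt{\frac n3}}}{2^{\frac52}\,3^{\frac14}\,n^{\frac34}}.$$
   Context: An odd strongly unimodal sequence of weight $n$ is a sequence of odd positive integers of the form $a_1<\cdots<a_r<c>b_1>\cdots>b_s$ (with $r,s\ge 0$) such that $n=c+\sum_{j=1}^r a_j+\sum_{j=1}^s b_j$. $\mathrm{ou}^*(n)$ denotes the number of odd strongly unimodal sequences of weight $n$ (for example $\mathrm{ou}^*(4)=2$). The notation $f(n)\sim g(n)$ means $f(n)/g(n)\to1$. *)

(* Defs.v *)
From mathcomp Require Import all_boot all_order all_algebra finmap.
From mathcomp Require Import all_classical all_reals all_analysis.
Import Order.TTheory GRing.Theory Num.Theory.
Import numFieldNormedType.Exports.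

Set Implicit Arguments.
Unset Strict Implicit.
Unset Printing Implicit Defensive.

Local Open Scope classical_set_scope.

(* [sorted ltn (rcons a c)] is a_1 < ... < a_r < c, and [sorted gtn (c :: b)]
   is c > b_1 > ... > b_s; all entries are positive since they are odd. *)
Definition odd_strongly_unimodal (s : seq nat) : Prop :=
  all odd s /\
  exists (a : seq nat) (c : nat) (b : seq nat),
    [/\ s = a ++ c :: b, sorted ltn (rcons a c) & sorted gtn (c :: b)].

(* The set is finite for every n, so [fset_set], which sends infinite sets to
   the empty set, loses nothing. *)
Definition ou_star (n : nat) : nat :=
  #|` fset_set [set s : seq nat | odd_strongly_unimodal s /\ sumn s = n] |.

Local Open Scope ring_scope.

Definition asymptotic_equiv (R : realType) (f g : nat -> R) : Prop :=
  (fun n => f n / g n) @ \oo --> (1 : R).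

(* Main.v *)
(* A sequence with peak c is a pair (A, B) of finite sets of odd positive
   integers with max A = c > max B.  Comparing the two maxima of an arbitrary
   pair gives P(q) = 1 + 2 O(q) + E(q), where P(q) = prod_j (1 + q^(2j+1))^2
   counts all pairs, O counts ou* and E counts the pairs with equal maxima
   ("ties").

   For P we prove a local limit theorem.  With q = e^-t, the coefficient of q^n
   is e^(nt) P(e^-t) times the probability that a sum of independent weighted
   Bernoulli variables equals n; at t = sqrt(eta(2) / n), eta(2) = pi^2 / 12,
   its mean is n + O(1/t) and its variance is about 2 eta(2) / t^3.  Fourier
   inversion on the scale theta = t^(3/2) u and dominated convergence reduce
   the probability to a Gaussian integral.  The midpoint rule gives
   log P(e^-t) = eta(2) / t + O(t), and convexity turns this single estimate
   into the ones for the mean and the variance.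

   The ties are negligible: E(e^-t) is much smaller than sqrt(t) P(e^-t), and
   raising the common maximum by 2 shows that the number of ties does not
   decrease from n to n + 4, so averaging over a window of length 1/t bounds
   the coefficient of E. *)

Require Import Defs.
From mathcomp Require Import all_boot all_order all_algebra finmap complex.
From mathcomp Require Import all_classical all_reals all_analysis.
From mathcomp Require Import measurable_realfun zify ring lra.
Import Order.TTheory GRing.Theory Num.Theory.
Import numFieldNormedType.Exports.
Import Normc.
Set Implicit Arguments.
Unset Strict Implicit.
Unset Printing Implicit Defensive.
Local Open Scope ring_scope.


(** * Enumeration of the sequences *)

Fixpoint odd_increasing (m : nat) : seq (seq nat) :=
  if m is m'.+1 then
    odd_increasing m' ++ [seq rcons a m'.*2.+1 | a <- odd_increasing m']
  else [:: [::]].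

Lemma sorted_rcons_ltn (a : seq nat) x :
  sorted ltn (rcons a x) = sorted ltn a && all (ltn^~ x) a.
Proof.
case: a => [//|y a] /=.
rewrite (path_sortedE (@ltn_trans)) (path_sortedE (@ltn_trans)).
elim: a y => [|z a IH] y /=; first by rewrite !andbT.
rewrite all_rcons (path_sortedE (@ltn_trans)) all_rcons.
have := IH z; rewrite (path_sortedE (@ltn_trans)) all_rcons.
by case: (y < z)%N; case: (z < x)%N; case: (y < x)%N;
  case: (all (ltn y) a); case: (all _ a) => //=; rewrite ?andbF ?andbT //=; lia.
Qed.

Lemma mem_odd_increasing m a :
  (a \in odd_increasing m) =
  [&& sorted ltn a, all odd a & all (ltn^~ m.*2) a].
Proof.
elim: m a => [|m IH] a /=.
  rewrite inE; case: a => [//|x a] /=; by rewrite !andbF.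
rewrite mem_cat IH.
case/lastP: a => [//|a x].
rewrite sorted_rcons_ltn !all_rcons.
have -> : (rcons a x \in [seq rcons a0 m.*2.+1 | a0 <- odd_increasing m]) =
   (x == m.*2.+1) && (a \in odd_increasing m).
  apply/mapP/andP => [[b bm /rcons_inj[-> ->]]|[/eqP -> am]]; first by [].
  by exists a.
rewrite IH.
case ha : (all (ltn^~ m.*2) a).
  have -> : all (ltn^~ m.+1.*2) a.
    by apply: sub_all ha => y /=; rewrite doubleS; lia.
  case: (eqVneq x m.*2.+1) => [->|xm].
    have -> : all (ltn^~ m.*2.+1) a by apply: sub_all ha => y /=; lia.
    rewrite doubleS /= odd_double /=.
    by case: (sorted _ _); case: (all odd a) => //=; lia.
  rewrite orbF /= !andbT doubleS; case ox: (odd x) => //=.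
  by congr [&& _ , _ & _]; lia.
rewrite !andbF /=; apply/esym/negbTE/negP => /and3P[/andP[_ h1] /andP[ox h2] /andP[hx h3]].
move/negP: ha; apply; apply/allP => y ya /=.
have := allP h1 _ ya; have := allP h2 _ ya => /= oy yx.
by move: hx; rewrite doubleS; lia.
Qed.

Lemma odd_increasing_uniq m : uniq (odd_increasing m).
Proof.
elim: m => [//|m IH] /=; rewrite cat_uniq IH map_inj_uniq ?IH ?andbT /=; last first.
  by move=> a b /rcons_inj[].
apply/hasPn => _ /mapP[a _ ->].
by rewrite mem_odd_increasing !all_rcons /=; lia.
Qed.

Definition unimodal_seq (p : nat * (seq nat * seq nat)) : seq nat :=
  p.2.1 ++ p.1.*2.+1 :: rev p.2.2.

Definition unimodal_codes (N : nat) : seq (nat * (seq nat * seq nat)) :=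
  [seq (m, p) | m <- iota 0 N,
    p <- [seq (a, b) | a <- odd_increasing m, b <- odd_increasing m]].

Definition unimodal_list N := map unimodal_seq (unimodal_codes N).

Lemma mem_unimodal_codes N m a b :
  ((m, (a, b)) \in unimodal_codes N) =
  [&& (m < N)%N, a \in odd_increasing m & b \in odd_increasing m].
Proof.
apply/allpairsPdep/and3P => [[m' [[a' b'] [+ /allpairsPdep[a'' [b'' []]]]]]|].
  by rewrite mem_iota add0n => /= mN aa bb [-> ->] [-> -> ->].
case=> mN am bm; exists m, (a, b); rewrite mem_iota; split => //.
by apply/allpairsPdep; exists a, b.
Qed.

Lemma unimodal_codes_uniq N : uniq (unimodal_codes N).
Proof.
apply: allpairs_uniq_dep; first exact: iota_uniq.
  move=> m _; apply: allpairs_uniq; try exact: odd_increasing_uniq.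
  by move=> [? ?] [? ?].
by move=> [m p] [m' p'] _ _ /= [-> ->].
Qed.

Lemma cat_peak_inj (T : eqType) (c : T) (a a' b b' : seq T) :
  c \notin a -> c \notin a' -> a ++ c :: b = a' ++ c :: b' -> a = a' /\ b = b'.
Proof.
elim: a a' => [|x a IH] [|x' a'] /=.
- by move=> _ _ [->].
- by rewrite inE => _ /norP[/eqP h _] [/h].
- by rewrite inE => /norP[/eqP h _] _ [e]; rewrite e in h.
rewrite !inE => /norP[_ ca] /norP[_ ca'] [-> e].
by have [-> ->] := IH _ ca ca' e.
Qed.

Lemma unimodal_seq_inj N : {in unimodal_codes N &, injective unimodal_seq}.
Proof.
move=> [m [a b]] [m' [a' b']]; rewrite !mem_unimodal_codes.
case/and3P=> _ ha hb /and3P[_ ha' hb'].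
rewrite !mem_odd_increasing in ha hb ha' hb'.
case/and3P: ha => _ _ /allP /= ha; case/and3P: hb => _ _ /allP /= hb.
case/and3P: ha' => _ _ /allP /= ha'; case/and3P: hb' => _ _ /allP /= hb'.
rewrite /unimodal_seq /= => e.
have mm' : m = m'.
  have h : m.*2.+1 \in a' ++ m'.*2.+1 :: rev b'.
    by rewrite -e mem_cat inE eqxx orbT.
  have h' : m'.*2.+1 \in a ++ m.*2.+1 :: rev b.
    by rewrite e mem_cat inE eqxx orbT.
  rewrite mem_cat inE mem_rev in h; rewrite mem_cat inE mem_rev in h'.
  have {}h : (m <= m')%N by case/or3P: h => [/ha'|/eqP|/hb']; lia.
  have {}h' : (m' <= m)%N by case/or3P: h' => [/ha|/eqP|/hb]; lia.
  lia.
subst m'; have nin (s : seq nat) : {in s, forall x, x < m.*2}%N -> m.*2.+1 \notin s.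
  by move=> hs; apply/negP => /hs; lia.
by have [-> /(can_inj revK) ->] := @cat_peak_inj _ _ _ _ _ _ (nin _ ha) (nin _ ha') e.
Qed.

Lemma sorted_gtn_cons c (b : seq nat) :
  sorted gtn (c :: b) = sorted ltn (rcons (rev b) c).
Proof. by rewrite -rev_cons rev_sorted. Qed.

Lemma unimodal_listP N s : (sumn s <= N)%N ->
  reflect (odd_strongly_unimodal s) (s \in unimodal_list N).
Proof.
move=> sN; apply: (iffP mapP).
  move=> [[m [a b]]]; rewrite mem_unimodal_codes !mem_odd_increasing.
  case/and3P => mN /and3P[sa oa /allP /= la] /and3P[sb ob /allP /= lb] ->.
  rewrite /unimodal_seq; split => /=.
    by rewrite all_cat oa /= odd_double all_rev.
  exists a, m.*2.+1, (rev b); split=> //.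
    rewrite sorted_rcons_ltn sa; apply/allP => x /la /=; lia.
  rewrite -[path _ _ _]/(sorted gtn (_ :: _)) sorted_gtn_cons revK sorted_rcons_ltn sb;
    apply/allP => x /lb /=; lia.
move=> [os [a [c [b [es ac cb]]]]].
move: os; rewrite es all_cat /= => /and3P[oa oc ob].
rewrite sorted_gtn_cons in cb; move: ac cb; rewrite !sorted_rcons_ltn.
move=> /andP[sa /allP /= la] /andP[sb /allP /= lb].
exists (c./2, (a, rev b)); last first.
  by rewrite /unimodal_seq /= revK; congr (_ ++ _ :: _); move: oc; lia.
rewrite mem_unimodal_codes !mem_odd_increasing sa sb oa all_rev ob /=.
have cN : (c <= N)%N.
  by apply: leq_trans sN; rewrite es sumn_cat /=; lia.
apply/and3P; split; first by move: oc; lia.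
  apply/allP => x xa /=; have /= := allP oa _ xa; have := la _ xa; move: oc; lia.
apply/allP => x xa /=; have := lb _ xa; rewrite mem_rev in xa.
have /= := allP ob _ xa; move: oc; lia.
Qed.

Lemma ou_starE n N : (n <= N)%N ->
  ou_star n = count (fun s => sumn s == n) (unimodal_list N).
Proof.
move=> nN; rewrite -size_filter /ou_star.
set X := [set s | _]%classic; set l := [seq s <- _ | _].
have Xl s : X s <-> s \in l.
  rewrite mem_filter; split.
    by move=> [us sn]; rewrite sn eqxx /=; apply/(unimodal_listP _) => //; rewrite sn.
  move=> /andP[/eqP sn sl]; split => //.
  by apply/(@unimodal_listP N) => //; rewrite sn.
have -> : fset_set X = [fset s in l]%fset.
  rewrite -[RHS]set_fsetK; congr fset_set; apply/seteqP; split => s /=.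
    by move=> /Xl; rewrite !inE.
  by rewrite !inE => /Xl.
rewrite card_fseq undup_id // filter_uniq // map_inj_in_uniq.
  exact: unimodal_codes_uniq.
exact: unimodal_seq_inj.
Qed.

(** * Generating polynomials *)

Section polynomials.
Variable R : numDomainType.
Implicit Types p q : {poly R}.

Definition odd_prod m : {poly R} := \prod_(j < m) (1 + 'X^(j.*2.+1)).
(* Generating polynomials of the pairs of sets of odd numbers: [pair_poly m] for
   all pairs below 2m+1, [strict_poly] for pairs whose first maximum is larger,
   [tied_poly] for nonempty pairs with equal maxima. *)
Definition pair_poly m : {poly R} := odd_prod m ^+ 2.
Definition strict_poly N : {poly R} := \sum_(m < N) 'X^(m.*2.+1) * pair_poly m.
Definition tied_poly N : {poly R} := \sum_(m < N) 'X^(m.*2.+1) ^+ 2 * pair_poly m.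

Lemma odd_prodS m : odd_prod m.+1 = odd_prod m * (1 + 'X^(m.*2.+1)).
Proof. by rewrite /odd_prod big_ord_recr. Qed.

Lemma pair_polyS m :
  pair_poly m.+1 = pair_poly m * (1 + 'X^(m.*2.+1) *+ 2 + 'X^(m.*2.+1) ^+ 2).
Proof. by rewrite /pair_poly odd_prodS; ring. Qed.

Lemma pair_poly_split N : pair_poly N = 1 + strict_poly N *+ 2 + tied_poly N.
Proof.
elim: N => [|N IH].
  by rewrite /pair_poly /strict_poly /tied_poly /odd_prod !big_ord0; ring.
rewrite pair_polyS /strict_poly /tied_poly !big_ord_recr /=.
rewrite -/(strict_poly N) -/(tied_poly N) {1}mulrDr mulrDr mulr1 {1}IH; ring.
Qed.

Lemma sum_odd_increasing m :
  \sum_(a <- odd_increasing m) 'X^(sumn a) = odd_prod m.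
Proof.
elim: m => [|m IH] /=; first by rewrite big_seq1 /odd_prod big_ord0 expr0.
rewrite big_cat /= IH odd_prodS mulrDr mulr1; congr (_ + _).
rewrite big_map -IH mulr_suml; apply: eq_bigr => a _.
by rewrite sumn_rcons exprD.
Qed.

Lemma sum_unimodal_list N :
  \sum_(s <- unimodal_list N) 'X^(sumn s) = strict_poly N.
Proof.
rewrite big_map big_allpairs_dep /strict_poly -[in RHS](big_mkord xpredT
  (fun m => 'X^(m.*2.+1) * pair_poly m)) /index_iota subn0.
apply: eq_bigr => m _; rewrite /pair_poly -sum_odd_increasing big_allpairs_dep /=.
rewrite expr2 mulr_suml mulr_sumr; apply: eq_bigr => a _.
rewrite mulr_sumr mulr_sumr; apply: eq_bigr => b _.
by rewrite -!exprD /unimodal_seq /= sumn_cat /= sumn_rev addnCA.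
Qed.

Lemma ou_star_coef n N : (n <= N)%N -> (ou_star n)%:R = (strict_poly N)`_n.
Proof.
move=> nN; rewrite (ou_starE nN) -sum_unimodal_list coef_sum.
rewrite -sum1_count natr_sum big_mkcond /=.
by apply: eq_bigr => s _; rewrite coefXn eq_sym; case: eqP.
Qed.

Definition poly_le p q := forall k, p`_k <= q`_k.

Lemma poly_le_sum (I : finType) (F G : I -> {poly R}) :
  (forall i, poly_le (F i) (G i)) -> poly_le (\sum_i F i) (\sum_i G i).
Proof. by move=> h k; rewrite !coef_sum; apply: ler_sum => i _; apply: h. Qed.

Lemma poly_leM p q r : poly_le 0 r -> poly_le p q -> poly_le (r * p) (r * q).
Proof.
move=> r0 pq k; rewrite !coefM; apply: ler_sum => i _; apply: ler_wpM2l => //.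
by have := r0 i; rewrite coef0.
Qed.

Lemma poly_le0Xn n : poly_le 0 'X^n.
Proof. by move=> k; rewrite coef0 coefXn ler0n. Qed.

Lemma poly_le0M p q : poly_le 0 p -> poly_le 0 q -> poly_le 0 (p * q).
Proof. by move=> hp hq; have := poly_leM hp hq; rewrite mulr0. Qed.

Lemma poly_le0D p q : poly_le 0 p -> poly_le 0 q -> poly_le 0 (p + q).
Proof.
move=> hp hq k; rewrite coefD coef0 addr_ge0 //.
  by have := hp k; rewrite coef0.
by have := hq k; rewrite coef0.
Qed.

Lemma pair_poly_ge0 m : poly_le 0 (pair_poly m).
Proof.
have h : poly_le 0 (odd_prod m).
  apply: (big_ind (poly_le 0)).
  - exact: (poly_le0Xn 0).
  - exact: poly_le0M.
  by move=> j _; apply: poly_le0D; [exact: (poly_le0Xn 0) | exact: poly_le0Xn].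
by rewrite /pair_poly expr2; apply: poly_le0M.
Qed.

Lemma pair_poly_leS m : poly_le (pair_poly m) (pair_poly m.+1).
Proof.
have -> : pair_poly m.+1 = pair_poly m + pair_poly m *
    ('X^(m.*2.+1) + 'X^(m.*2.+1) + 'X^(m.*2.+1) * 'X^(m.*2.+1)).
  by rewrite pair_polyS; ring.
move=> k; rewrite coefD lerDl; rewrite -[leLHS](coef0 R k).
apply: poly_le0M; first exact: pair_poly_ge0.
by repeat first [apply: poly_le0D | apply: poly_le0M | exact: poly_le0Xn].
Qed.

Lemma tied_poly_term_ge0 m : poly_le 0 ('X^(m.*2.+1) ^+ 2 * pair_poly m).
Proof.
by rewrite -exprM; apply: poly_le0M; [exact: poly_le0Xn | exact: pair_poly_ge0].
Qed.

Lemma tied_poly_ge0 N : poly_le 0 (tied_poly N).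
Proof.
apply: (big_ind (poly_le 0)).
- by move=> k.
- exact: poly_le0D.
- by move=> m _; exact: tied_poly_term_ge0.
Qed.

Lemma tied_poly_leS N : poly_le (tied_poly N) (tied_poly N.+1).
Proof.
move=> k; rewrite /tied_poly big_ord_recr /= coefD lerDl.
by have := tied_poly_term_ge0 N k; rewrite coef0.
Qed.

Lemma tied_poly_coef_shift N k : (tied_poly N)`_k <= (tied_poly N.+1)`_(k + 4).
Proof.
have -> : (tied_poly N)`_k = ('X^4 * tied_poly N)`_(k + 4).
  by rewrite coefXnM ltnNge leq_addl /= addnK.
have -> : tied_poly N.+1 = 'X^1 ^+ 2 * pair_poly 0 +
    'X^4 * \sum_(m < N) 'X^(m.*2.+1) ^+ 2 * pair_poly m.+1.
  rewrite /tied_poly big_ord_recl /=; congr (_ + _).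
  rewrite mulr_sumr; apply: eq_bigr => m _; rewrite mulrA; congr (_ * _).
  by rewrite -!exprM -exprD; congr ('X^_); rewrite /bump /=; lia.
rewrite coefD ler_wpDl //.
  by have := tied_poly_term_ge0 0 (k + 4)%N; rewrite coef0.
apply: poly_leM; first exact: poly_le0Xn.
apply: poly_le_sum => m; rewrite -exprM; apply: poly_leM; first exact: poly_le0Xn.
exact: pair_poly_leS.
Qed.

(* Adding 2 to the common maximum of a tied pair is injective and raises the
   weight by 4, so tied pairs of weight k also contribute to the coefficients
   of k + 4, k + 8, ... *)
Lemma tied_poly_coef_horner N I k (r : R) : 0 <= r <= 1 ->
  (tied_poly N)`_k * r ^+ (k + 4 * I) *+ I <= (tied_poly (N + I)).[r].
Proof.
move=> /andP[r0 r1].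
have shift i : (i <= I)%N -> (tied_poly N)`_k <= (tied_poly (N + I))`_(k + 4 * i).
  move=> iI; have : (tied_poly N)`_k <= (tied_poly (N + i))`_(k + 4 * i).
    elim: i {iI} => [|i IH]; first by rewrite muln0 !addn0.
    apply: (le_trans IH); apply: (le_trans (tied_poly_coef_shift _ _)).
    rewrite (_ : k + 4 * i + 4 = k + 4 * i.+1)%N ?(addnS N) //; lia.
  move/le_trans; apply; have -> : (N + I = N + i + (I - i))%N by lia.
  elim: (I - i)%N => [|d IH]; first by rewrite addn0.
  by rewrite addnS; apply: (le_trans IH); apply: tied_poly_leS.
set p := tied_poly (N + I) in shift *.
have pge0 j : 0 <= p`_j by have := @tied_poly_ge0 (N + I) j; rewrite coef0.
have {}shift : (tied_poly N)`_k * r ^+ (k + 4 * I) *+ I <=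
    \sum_(0 <= j < k + 4 * I) p`_j * r ^+ j.
  rewrite -mulr_natl.
  suff h i : (i <= I)%N -> i%:R * ((tied_poly N)`_k * r ^+ (k + 4 * I)) <=
    \sum_(0 <= j < k + 4 * i) p`_j * r ^+ j by apply: h.
  elim: i => [|i IH] iI.
    by rewrite mul0r sumr_ge0 // => j _; rewrite mulr_ge0 ?exprn_ge0.
  have pr j : 0 <= p`_j * r ^+ j by rewrite mulr_ge0 ?exprn_ge0.
  have -> : (k + 4 * i.+1 = (k + 4 * i).+4)%N by lia.
  have {}IH := IH (ltnW iI).
  rewrite !big_nat_recr //= -!addrA -natr1 mulrDl mul1r lerD //.
  rewrite ler_wpDr ?addr_ge0 //; apply: ler_pM; rewrite ?exprn_ge0 //.
  - by have := @tied_poly_ge0 N k; rewrite coef0.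
  - by apply: shift; lia.
  - by apply: ler_wiXn2l => //; lia.
apply: (le_trans shift); rewrite (@horner_coef_wide _ (size p + (k + 4 * I))).
  rewrite -(big_mkord xpredT (fun j => p`_j * r ^+ j)).
  rewrite [leRHS](@big_cat_nat _ _ _ (k + 4 * I)) //= ?leq_addl // lerDl sumr_ge0 // => j _.
  by rewrite mulr_ge0 ?exprn_ge0.
exact: leq_addr.
Qed.
End polynomials.


(** * Elementary inequalities *)

Lemma ler_is_derive (R : realType) (f g df dg : R -> R) (a b : R) : a <= b ->
  (forall x, a <= x <= b -> is_derive x 1 f (df x)) ->
  (forall x, a <= x <= b -> is_derive x 1 g (dg x)) ->
  (forall x, a <= x <= b -> df x <= dg x) ->
  f b - f a <= g b - g a.
Proof.
move=> ab hf hg hfg.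
have hd x : a <= x <= b -> is_derive x 1 (g - f) (dg x - df x).
  by move=> /[dup] /hf fx /hg gx; apply: is_deriveB.
have [c cab e] : exists2 c, c \in `[a, b] &
    (g - f) b - (g - f) a = (dg c - df c) * (b - a).
  apply: (@MVT_segment R (g - f) (fun x => dg x - df x)) => //.
    by move=> x; rewrite in_itv /= => /andP[ax xb]; apply: hd; rewrite !ltW.
  apply: derivable_within_continuous => x; rewrite in_itv /= => /hd hx.
  exact: ex_derive.
have := hfg c; move: cab; rewrite in_itv /= => cab /(_ cab) h.
rewrite -subr_ge0 (_ : _ - _ = (dg c - df c) * (b - a)).
  by rewrite mulr_ge0 ?subr_ge0.
by rewrite -e /=; rewrite -!/(_ (- _) _) !fctE; ring.
Qed.

Section trigonometric_bounds.
Variable R : realType.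
Implicit Types x y : R.

Lemma sin_le x : 0 <= x -> sin x <= x.
Proof.
move=> x0.
have := @ler_is_derive R sin id cos (fun=> 1) 0 x x0.
rewrite sin0 !subr0; apply=> y _.
exact: cos_le1.
Qed.

Lemma cos_ge_sqr x : 0 <= x -> 1 - x ^+ 2 / 2 <= cos x.
Proof.
move=> x0.
have : - (x ^+ 2 / 2) - - (0 ^+ 2 / 2) <= cos x - cos 0.
  apply: (@ler_is_derive R (fun y => - (y ^+ 2 / 2)) cos (fun y => - y)
    (fun y => - sin y)) => // y /andP[y0 _].
  - by apply: is_derive_eq; rewrite /GRing.scale /=; field.
  - by rewrite lerN2 sin_le.
by rewrite cos0; lra.
Qed.

Lemma subr_sin_le_cube x : 0 <= x -> x - sin x <= x ^+ 3 / 6.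
Proof.
move=> x0.
have : x - sin x - (0 - sin 0) <= x ^+ 3 / 6 - 0 ^+ 3 / 6.
  apply: (@ler_is_derive R (fun y => y - sin y) (fun y => y ^+ 3 / 6)
     (fun y => 1 - cos y) (fun y => y ^+ 2 / 2)) => // y /andP[y0 _].
  - by apply: is_derive_eq; rewrite /GRing.scale /=; field.
  - by have := cos_ge_sqr y0; lra.
by rewrite sin0 expr0n /=; lra.
Qed.

Lemma subr_cos_le x : 0 <= x -> 1 - cos x <= x.
Proof.
move=> x0; have : - cos x - - cos 0 <= x - 0.
  apply: (@ler_is_derive R (fun y => - cos y) id sin (fun=> 1)) => // y _.
  by apply: is_derive_eq; rewrite opprK.
by rewrite cos0; lra.
Qed.

Lemma subr_sin_le_sqr x : 0 <= x -> x - sin x <= x ^+ 2 / 2.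
Proof.
move=> x0.
have : x - sin x - (0 - sin 0) <= x ^+ 2 / 2 - 0 ^+ 2 / 2.
  apply: (@ler_is_derive R (fun y => y - sin y) (fun y => y ^+ 2 / 2)
     (fun y => 1 - cos y) id) => // y /andP[y0 _].
  - by apply: is_derive_eq; rewrite /GRing.scale /=; field.
  - exact: subr_cos_le.
by rewrite sin0 expr0n /=; lra.
Qed.

Lemma cos_le_cube x : 0 <= x -> cos x - 1 + x ^+ 2 / 2 <= x ^+ 3 / 6.
Proof.
move=> x0.
have : cos x + x ^+ 2 / 2 - (cos 0 + 0 ^+ 2 / 2) <= x ^+ 3 / 6 - 0 ^+ 3 / 6.
  apply: (@ler_is_derive R (fun y => cos y + y ^+ 2 / 2) (fun y => y ^+ 3 / 6)
   (fun y => y - sin y) (fun y => y ^+ 2 / 2)) => // y /andP[y0 _].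
  - by apply: is_derive_eq; rewrite /GRing.scale /=; field.
  - by apply: is_derive_eq; rewrite /GRing.scale /=; field.
  - exact: subr_sin_le_sqr.
by rewrite cos0 !expr0n /=; lra.
Qed.

Lemma cos_taylor x : `|cos x - 1 + x ^+ 2 / 2| <= `|x| ^+ 3 / 6.
Proof.
wlog x0 : x / 0 <= x.
  move=> h; have [/h //|/ltW x0] := leP 0 x.
  by have := h (- x); rewrite oppr_ge0 cosN sqrrN normrN; apply.
rewrite [X in X ^+ 3]ger0_norm // ger0_norm ?cos_le_cube //.
by have := cos_ge_sqr x0; lra.
Qed.

Lemma sin_taylor x : `|sin x - x| <= `|x| ^+ 3 / 6.
Proof.
wlog x0 : x / 0 <= x.
  move=> h; have [/h //|/ltW x0] := leP 0 x.
  by have := h (- x); rewrite oppr_ge0 sinN -opprD !normrN; apply.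
rewrite [X in X ^+ 3]ger0_norm // distrC ger0_norm ?subr_sin_le_cube //.
by rewrite subr_ge0 sin_le.
Qed.

Lemma sin_ge_third x : 0 <= x <= 2 -> x / 3 <= sin x.
Proof.
move=> /andP[x0 x2]; have := subr_sin_le_cube x0.
have : x ^+ 3 <= 4 * x.
  have x4 : x ^+ 2 <= 4 by nra.
  by rewrite exprSr ler_wpM2r.
lra.
Qed.

End trigonometric_bounds.


(** * The value of eta(2) *)

Section basel.
Variable R : realType.
Implicit Types x y : R.

Lemma mul_cos_le_sin y : 0 <= y <= pi -> y * cos y <= sin y.
Proof.
move=> /andP[y0 ypi].
have : y * cos y - 0 * cos 0 <= sin y - sin 0.
  apply: (@ler_is_derive R (fun x => x * cos x) sin
    (fun x => cos x - x * sin x) cos) => // x /andP[x0 xy].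
    by apply: is_derive_eq; rewrite /GRing.scale /=; ring.
  rewrite gerBl mulr_ge0 // sin_ge0_pi // x0; exact: le_trans ypi.
by rewrite sin0; lra.
Qed.

Lemma inv_sin_sqr_bounds y : 0 < y < pi / 2 ->
  (sin y)^-2 - 1 <= y^-2 <= (sin y)^-2.
Proof.
move=> /[dup] hy /andP[y0 yp].
have s0 : 0 < sin y by apply: sin_gt0_pihalf.
have c0 : 0 < cos y by apply: cos_gt0_pihalf; rewrite yp andbT; lra.
have h1 := sin_le (ltW y0).
have h2 : y * cos y <= sin y by apply: mul_cos_le_sin; rewrite ltW //=; lra.
apply/andP; split; last first.
  by rewrite lef_pV2 ?posrE ?exprn_gt0 // lerXn2r ?nnegrE // ltW.
have -> : (sin y)^-2 - 1 = (cos y / sin y) ^+ 2.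
  rewrite -[X in _ - X](@mulfV _ (sin y ^+ 2)) ?expf_neq0 ?gt_eqF //.
  by rewrite -{1}[(_ ^- 2)]mul1r -mulrBl -cos2sin2 expr_div_n.
rewrite -exprVn lerXn2r ?nnegrE ?divr_ge0 ?invr_ge0 ?(ltW s0) ?(ltW c0) ?(ltW y0) //.
by rewrite ler_pdivrMr // mulrC ler_pdivlMr // mulrC.
Qed.

(* Each halving doubles the number of angles and multiplies the sum of 1/sin^2
   by 4, which evaluates the finite analogues of Basel's series exactly. *)
Lemma inv_sin_sqr_halve y : 0 < y < pi ->
  (sin y)^-2 = ((sin (y / 2))^-2 + (sin ((pi - y) / 2))^-2) / 4.
Proof.
move=> /andP[y0 yp].
have -> : (pi - y) / 2 = - (y / 2 - pi / 2) by field.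
rewrite sinN sinBpihalf opprK.
have s0 : sin (y / 2) != 0 by rewrite gt_eqF // sin_gt0_pihalf //; lra.
have c0 : cos (y / 2) != 0 by rewrite gt_eqF // cos_gt0_pihalf //; lra.
have -> : sin y = 2 * (cos (y / 2) * sin (y / 2)).
  have {1}-> : y = (y / 2) *+ 2 by rewrite -mulr_natr; field.
  by rewrite sin_mulr2n mulr_natl.
have h := cos2Dsin2 (y / 2).
have -> : (2 * (cos (y / 2) * sin (y / 2))) ^- 2 =
  (cos (y/2) ^+ 2 + sin (y/2) ^+ 2) / (2 * (cos (y / 2) * sin (y / 2))) ^+ 2.
  by rewrite h mul1r.
field; by rewrite s0 c0.
Qed.

Definition odd_angle p k : R := (2 * k + 1)%:R * pi / 2 ^+ p.+2.

Lemma odd_angle_bounds p k : (k < 2 ^ p)%N -> 0 < odd_angle p k < pi / 2.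
Proof.
move=> kp; have p0 : 0 < pi :> R := pi_gt0 R; have e0 : 0 < 2 ^+ p :> R by rewrite exprn_gt0.
apply/andP; split.
  by rewrite /odd_angle divr_gt0 ?exprn_gt0 // mulr_gt0 // ltr0n addn1.
rewrite /odd_angle.
rewrite ltr_pdivrMr ?exprn_gt0 // mulrC !exprS !mulrA divfK // -mulrA ltr_pM2l //.
by rewrite -natrX -natrM ltr_nat; lia.
Qed.

Lemma sum_inv_sin_sqr p :
  \sum_(k < 2 ^ p) (sin (odd_angle p k))^-2 = 2 * 4 ^+ p.
Proof.
elim: p => [|p IH].
  have := @inv_sin_sqr_halve (pi / 2).
  have -> : (pi - pi / 2) / 2 = odd_angle 0 0 by rewrite /odd_angle; field.
  have -> : pi / 2 / 2 = odd_angle 0 0 by rewrite /odd_angle; field.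
  rewrite sin_pihalf expr1n invr1 big_ord1 => h.
  have p0 : 0 < pi :> R := pi_gt0 R.
  by have := h ltac:(lra); lra.
have -> : (2 ^ p.+1 = 2 ^ p + 2 ^ p)%N by rewrite expnS mul2n addnn.
rewrite big_split_ord /= [X in _ + X](reindex_inj rev_ord_inj) /= -big_split /=.
rewrite exprS mulrCA -IH mulr_sumr; apply: eq_bigr => k _.
have kp := ltn_ord k; rewrite (@inv_sin_sqr_halve (odd_angle p k)); last first.
  by have := odd_angle_bounds kp; have := pi_gt0 R; lra.
have e0 : 2 ^+ p != 0 :> R by rewrite expf_neq0.
rewrite mulrC divfK //; congr (_ ^-2 + _ ^-2); congr sin.
  by rewrite /odd_angle !exprS; field.
rewrite /odd_angle.
have -> : (2 * (2 ^ p + (2 ^ p - k.+1)) + 1)%:R = 2 ^+ p * 4 - (2 * k + 1)%:R :> R.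
  apply/eqP; rewrite -subr_eq0 opprB addrA subr_eq0 -natrX -!natrM -natrD; apply/eqP;
    congr _%:R; lia.
by rewrite !exprS; field.
Qed.

Lemma odd_inv_sqr_sum_bounds p :
  (pi : R) ^+ 2 / 8 - pi ^+ 2 / 16 / 2 ^+ p <=
  \sum_(k < 2 ^ p) (2 * k + 1)%:R ^-2 <= (pi : R) ^+ 2 / 8.
Proof.
have e0 : 2 ^+ p != 0 :> R by rewrite expf_neq0.
have p0 : pi != 0 :> R by rewrite gt_eqF ?pi_gt0.
have e4 : 4 ^+ p = 2 ^+ p * 2 ^+ p :> R by rewrite -exprMn; congr (_ ^+ _); ring.
pose c : R := pi ^+ 2 / 16 / 4 ^+ p.
have c0 : 0 <= c by rewrite !divr_ge0 ?exprn_ge0 ?pi_ge0.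
have -> : \sum_(k < 2 ^ p) (2 * k + 1)%:R ^-2 =
    c * \sum_(k < 2 ^ p) (odd_angle p k) ^-2.
  rewrite mulr_sumr; apply: eq_bigr => k _.
  have k0 : (2 * k + 1)%:R != 0 :> R by rewrite pnatr_eq0 addn1.
  rewrite /c /odd_angle e4 !exprS; move: (2 * k + 1)%:R k0 pi p0 => u u0 q q0.
  by field; rewrite u0 e0 q0.
have -> : pi ^+ 2 / 8 = c * (2 * 4 ^+ p) by rewrite /c e4; field.
have -> : pi ^+ 2 / 16 / 2 ^+ p = c * (2 ^ p)%:R.
  by rewrite natrX /c e4; field.
rewrite -mulrBr -sum_inv_sin_sqr; apply/andP; split; apply: ler_wpM2l => //.
  have -> : (2 ^ p)%:R = \sum_(k < 2 ^ p) 1 :> R by rewrite sumr_const card_ord.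
  rewrite -sumrB; apply: ler_sum => k _.
  by have /inv_sin_sqr_bounds/andP[] := odd_angle_bounds (ltn_ord k).
apply: ler_sum => k _.
by have /inv_sin_sqr_bounds/andP[] := odd_angle_bounds (ltn_ord k).
Qed.

Lemma big_even_odd m (F : nat -> R) :
  \sum_(k < 2 * m) F k = \sum_(k < m) (F (2 * k)%N + F (2 * k + 1)%N).
Proof.
elim: m => [|m IH]; first by rewrite !big_ord0.
have -> : (2 * m.+1 = (2 * m).+2)%N by lia.
by rewrite !big_ord_recr /= IH -addrA addn1.
Qed.

Lemma inv_sqr_sum_bound p :
  `|\sum_(k < 2 ^ p) k.+1%:R ^-2 - pi ^+ 2 / 6| <= (pi : R) ^+ 2 / 4 / 2 ^+ p.
Proof.
elim: p => [|p IH].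
  rewrite big_ord1 expr0 divr1 expr1n invr1 ler_norml.
  have := pihalf_ge1 R; have := pihalf_lt2 R => h1 h2.
  by apply/andP; split; nra.
have -> : (2 ^ p.+1 = 2 * 2 ^ p)%N by rewrite expnS.
rewrite (big_even_odd (2 ^ p) (fun k => k.+1%:R ^-2)) big_split /=.
have -> : \sum_(i < 2 ^ p) (2 * i + 1).+1%:R ^-2 = (\sum_(k < 2 ^ p) k.+1%:R ^-2) / 4 :> R.
  rewrite mulr_suml; apply: eq_bigr => k _.
  have -> : (2 * k + 1).+1%:R = 2 * k.+1%:R :> R by rewrite -natrM; congr _%:R; lia.
  have k0 : k.+1%:R != 0 :> R by rewrite pnatr_eq0.
  by field.
have -> : \sum_(i < 2 ^ p) (2 * i).+1%:R ^-2 = \sum_(k < 2 ^ p) (2 * k + 1)%:R ^-2 :> R.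
  by apply: eq_bigr => k _; rewrite addn1.
have := odd_inv_sqr_sum_bounds p; move: IH; rewrite (exprS 2 p) invfM mulrA.
have : 0 <= (2 ^+ p)^-1 :> R by rewrite invr_ge0 exprn_ge0.
rewrite !ler_norml; move: (2 ^+ p)^-1 (\sum_(_ < _) _) (\sum_(_ < _) _) (pi ^+ 2).
by move=> e a b q; lra.
Qed.

Lemma eta2_bound p :
  `|\sum_(k < 2 ^ p.+1) (-1) ^+ k / k.+1%:R ^+ 2 - pi ^+ 2 / 12| <=
  (pi : R) ^+ 2 / 8 / 2 ^+ p.
Proof.
have -> : (2 ^ p.+1 = 2 * 2 ^ p)%N by rewrite expnS.
rewrite (big_even_odd (2 ^ p) (fun k => (-1) ^+ k / k.+1%:R ^+ 2)) big_split /=.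
have -> : \sum_(i < 2 ^ p) (-1) ^+ (2 * i + 1) / (2 * i + 1).+1%:R ^+ 2 =
   - ((\sum_(k < 2 ^ p) k.+1%:R ^-2) / 4) :> R.
  rewrite mulr_suml -sumrN; apply: eq_bigr => k _.
  have -> : (2 * k + 1).+1%:R = 2 * k.+1%:R :> R by rewrite -natrM; congr _%:R; lia.
  have k0 : k.+1%:R != 0 :> R by rewrite pnatr_eq0.
  rewrite addn1 exprS exprM sqrrN !expr1n; by field.
have -> : \sum_(i < 2 ^ p) (-1) ^+ (2 * i) / (2 * i).+1%:R ^+ 2 =
   \sum_(k < 2 ^ p) (2 * k + 1)%:R ^-2 :> R.
  by apply: eq_bigr => k _; rewrite addn1 exprM sqrrN !expr1n mul1r.
have := odd_inv_sqr_sum_bounds p; have := inv_sqr_sum_bound p.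
have : 0 <= (2 ^+ p)^-1 :> R by rewrite invr_ge0 exprn_ge0.
rewrite !ler_norml; move: (2 ^+ p)^-1 (\sum_(_ < _) _) (\sum_(_ < _) _) (pi ^+ 2).
by move=> e a b q; lra.
Qed.

End basel.


(** * Asymptotics of log P, the mean and the variance *)

Section primitive.
Variable R : realType.

Lemma continuous_primitive (f : R -> R) (a : R) : continuous f ->
  exists F : R -> R, forall x : R, a < x -> is_derive x 1 F (f x).
Proof.
move=> cf; exists (fun x => \int[@lebesgue_measure R]_(t in `[a, x]) f t)%R => x ax.
have fi : (@lebesgue_measure R).-integrable `[a, x + 1] (EFin \o f).
  apply: continuous_compact_integrable; first exact: segment_compact.
  exact: continuous_subspaceT.
have [dF F'] := @continuous_FTC1_closed R f a x (x + 1) (ltac:(lra)) fi ax (cf x).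
by apply: DeriveDef; [exact: dF | rewrite -derive1E].
Qed.

End primitive.

Section softplus.
Variable R : realType.
Implicit Types x y d : R.

Definition soft x := ln (1 + expR (- x)).
Definition fermi x := (1 + expR x)^-1.

Lemma onepexp_gt0 x : 0 < 1 + expR x.
Proof. by rewrite addr_gt0 ?expR_gt0. Qed.
Hint Resolve onepexp_gt0 : core.

Lemma fermi_gt0 x : 0 < fermi x. Proof. by rewrite invr_gt0. Qed.

Lemma fermiN x : fermi (- x) = 1 - fermi x.
Proof.
rewrite /fermi expRN; have := expR_gt0 x; move: (expR x) => e e0.
by field; rewrite !gt_eqF // ?addr_gt0.
Qed.

Lemma fermi_le1 x : fermi x <= 1.
Proof. by rewrite -subr_ge0 -fermiN ltW ?fermi_gt0. Qed.

Lemma fermi_le x y : x <= y -> fermi y <= fermi x.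
Proof. by move=> xy; rewrite /fermi lef_pV2 ?posrE // lerD2l ler_expR. Qed.

Lemma fermi_le_expRN x : fermi x <= expR (- x).
Proof.
by rewrite /fermi expRN lef_pV2 ?posrE ?expR_gt0 // lerDr.
Qed.

(* Weighted AM-GM: 1 - p + p e^d >= e^(pd). *)
Lemma soft_tangent x y : soft x - fermi x * (y - x) <= soft y.
Proof.
have -> : soft x - fermi x * (y - x) = ln ((1 + expR (- x)) * expR (- (fermi x * (y - x)))).
  by rewrite lnM ?posrE ?expR_gt0 // expRK.
rewrite ler_ln ?posrE ?mulr_gt0 ?expR_gt0 //.
set p := fermi x; set d := x - y.
have -> : 1 + expR (- y) = (1 + expR (- x)) * ((1 - p) + p * expR d).
  rewrite /p /d /fermi expRD !expRN; have := expR_gt0 y; move: (expR y) => e' e0';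
    have := expR_gt0 x; move: (expR x) => e e0.
  by field; rewrite !gt_eqF // ?addr_gt0.
rewrite ler_pM2l // -[- _]mulrN opprB -/d.
have p0 : 0 <= p := ltW (fermi_gt0 x); have p1 : 0 <= 1 - p by rewrite subr_ge0 fermi_le1.
have -> : (1 - p) + p * expR d =
    expR (p * d) * ((1 - p) * expR (- (p * d)) + p * expR ((1 - p) * d)).
  have a1 : expR (p * d) * expR (- (p * d)) = 1 by rewrite -expRD subrr expR0.
  have a2 : expR (p * d) * expR ((1 - p) * d) = expR d.
    by rewrite -expRD; congr expR; ring.
  by rewrite mulrDr !(mulrCA (expR (p * d))) a1 a2 mulr1.
rewrite ler_peMr ?expR_ge0 //.
have h1 : (1 - p) * (1 - p * d) <= (1 - p) * expR (- (p * d)).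
  by apply: ler_wpM2l => //; exact: expR_ge1Dx.
have h2 : p * (1 + (1 - p) * d) <= p * expR ((1 - p) * d).
  by apply: ler_wpM2l => //; exact: expR_ge1Dx.
lra.
Qed.

Lemma expR_tanh_ineq d : 0 <= d -> 0 <= 2 * (1 - expR d) + d * (1 + expR d).
Proof.
move=> d0.
have : (0 : R) - 0 <= (2 * (1 - expR d) + d * (1 + expR d)) - (2 * (1 - expR 0) + 0 * (1 + expR 0)).
  apply: (@ler_is_derive R (fun=> 0) (fun d => 2 * (1 - expR d) + d * (1 + expR d))
   (fun=> 0) (fun d => 1 - expR d + d * expR d) 0 d) => // z /andP[z0 _].
    by apply: is_derive_eq; rewrite /GRing.scale /=; ring.
  have -> : 1 - expR z + z * expR z = expR z * (expR (- z) - (1 - z)).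
    by rewrite mulrBr -expRD subrr expR0; ring.
  by rewrite mulr_ge0 ?expR_ge0 // subr_ge0 expR_ge1Dx.
by rewrite expR0; lra.
Qed.

Lemma expR_sinh_ineq d : 0 <= d -> 2 * d <= expR d - expR (- d).
Proof.
move=> d0.
have : 2 * d - 2 * 0 <= (expR d - expR (- d)) - (expR 0 - expR (- 0)).
  apply: (@ler_is_derive R (fun d => 2 * d) (fun d => expR d - expR (- d))
   (fun=> 2) (fun d => expR d + expR (- d))) => // z _.
  - by apply: is_derive_eq; rewrite /GRing.scale /=; ring.
  - by apply: is_derive_eq; rewrite /GRing.scale /=; ring.
  - rewrite expRN; have := expR_gt0 z; move: (expR z) => e e0.
    rewrite -subr_ge0 (_ : _ - _ = (e - 1) ^+ 2 / e); last by field; rewrite gt_eqF.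
    by rewrite divr_ge0 ?sqr_ge0 ?ltW.
by rewrite oppr0 expR0; lra.
Qed.

(* Clearing denominators, the difference is affine in w = e^x, and it suffices to
   look at the smallest admissible w: 1 if x <= y, and e^(x - y) otherwise. *)
Lemma fermi_tangent x y : 0 <= x -> 0 <= y ->
  fermi x - fermi x * (1 - fermi x) * (y - x) <= fermi y.
Proof.
move=> x0 y0; set d := y - x.
have -> : fermi y = (1 + expR x * expR d)^-1.
  by rewrite -expRD (_ : x + d = y) // /d; ring.
rewrite -subr_ge0 /fermi; have w1 : 1 <= expR x by rewrite -expR0 ler_expR.
set w := expR x in w1 *; have w0 : 0 < w by lra.
have e0 := expR_gt0 d; set e := expR d in e0 *.
have -> : (1 + w * e)^-1 - ((1 + w)^-1 - (1 + w)^-1 * (1 - (1 + w)^-1) * d) =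
  w * ((1 - e + d) + w * (1 - e + d * e)) / ((1 + w) ^+ 2 * (1 + w * e)).
  by field; rewrite !gt_eqF // ?addr_gt0 ?mulr_gt0.
rewrite divr_ge0 //; last first.
  by rewrite mulr_ge0 ?exprn_ge0 ?addr_ge0 ?mulr_ge0 ?(ltW w0) ?(ltW e0).
apply: mulr_ge0; first exact: ltW.
have c0 : 0 <= 1 - e + d * e.
  have -> : 1 - e + d * e = e * (expR (- d) - (1 - d)).
    by rewrite mulrBr /e -expRD subrr expR0; ring.
  by rewrite mulr_ge0 ?(ltW e0) // subr_ge0 expR_ge1Dx.
have [d0|d0] := leP 0 d.
  have := expR_tanh_ineq d0; rewrite -/e => h.
  have : (1 - e + d * e) <= w * (1 - e + d * e) by rewrite ler_peMl.
  lra.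
have we : e^-1 <= w by rewrite /e -expRN /w ler_expR /d; lra.
have : e^-1 * (1 - e + d * e) <= w * (1 - e + d * e) by rewrite ler_wpM2r.
have -> : e^-1 * (1 - e + d * e) = e^-1 - 1 + d by field; rewrite gt_eqF.
have := @expR_sinh_ineq (- d); rewrite opprK expRN -/e oppr_ge0 => /(_ (ltW d0)).
lra.
Qed.

Lemma is_derive_soft x : is_derive x 1 soft (- fermi x).
Proof.
have h : is_derive (1 + expR (- x)) 1 (@ln R) (1 + expR (- x))^-1 by apply: is_derive1_ln.
have g : is_derive x 1 (fun x => 1 + expR (- x)) (- expR (- x)).
  by apply: is_derive_eq; rewrite /GRing.scale /=; ring.
have := @is_derive1_comp R (@ln R) (fun x => 1 + expR (- x)) x _ _ h g; rewrite /soft => hh.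
apply: (is_derive_eq hh).
rewrite /GRing.scale /= /fermi expRN; have := expR_gt0 x; move: (expR x) => e e0.
by field; rewrite !gt_eqF // ?addr_gt0.
Qed.

Lemma soft_continuous : continuous soft.
Proof.
move=> x; apply: differentiable_continuous; rewrite -derivable1_diffP.
by apply: ex_derive; exact: is_derive_soft.
Qed.

Lemma midpoint_bounds (I : R -> R) c t : 0 <= t -> t <= c ->
  (forall x, 0 <= x -> is_derive x 1 I (soft x)) ->
  2 * t * soft c <= I (c + t) - I (c - t) <=
  2 * t * soft c + (fermi (c - t) - fermi (c + t)) * t ^+ 2 / 2.
Proof.
move=> t0 tc dI.
have quad (s m x : R) : is_derive x 1 (fun x => s * x - m * (x - c) ^+ 2 / 2) (s - m * (x - c)).
  by apply: is_derive_eq; rewrite /GRing.scale /=; field.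
apply/andP; split.
  have : (fun x => soft c * x - fermi c * (x - c) ^+ 2 / 2) (c + t) -
      (fun x => soft c * x - fermi c * (x - c) ^+ 2 / 2) (c - t) <= I (c + t) - I (c - t).
    apply: (ler_is_derive _ (fun x _ => quad (soft c) (fermi c) x)); first lra.
      by move=> x hx; apply: dI; lra.
    by move=> x _; exact: soft_tangent.
  lra.
have : I c - I (c - t) <= (fun x => soft c * x - fermi (c - t) * (x - c) ^+ 2 / 2) c -
      (fun x => soft c * x - fermi (c - t) * (x - c) ^+ 2 / 2) (c - t).
  apply: (ler_is_derive _ _ (fun x _ => quad (soft c) (fermi (c - t)) x)); first lra.
    by move=> x hx; apply: dI; lra.
  move=> x hx; have := soft_tangent x c.
  have : fermi x * (c - x) <= fermi (c - t) * (c - x).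
    by apply: ler_wpM2r; [lra|apply: fermi_le; lra].
  lra.
have : I (c + t) - I c <= (fun x => soft c * x - fermi (c + t) * (x - c) ^+ 2 / 2) (c + t) -
      (fun x => soft c * x - fermi (c + t) * (x - c) ^+ 2 / 2) c.
  apply: (ler_is_derive _ _ (fun x _ => quad (soft c) (fermi (c + t)) x)); first lra.
    by move=> x hx; apply: dI; lra.
  move=> x hx; have := soft_tangent x c.
  have : fermi (c + t) * (x - c) <= fermi x * (x - c).
    by apply: ler_wpM2r; [lra|apply: fermi_le; lra].
  lra.
lra.
Qed.

End softplus.


Section softplus_integral.
Variable R : realType.
Implicit Types x y t s : R.

Lemma ge0_of_geometric (a c : R) : (forall p, 0 <= a + c / 2 ^+ p) -> 0 <= a.
Proof.
move=> h; rewrite leNgt; apply/negP => a0.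
pose p := Num.bound `|c / - a|.
have hp : c / - a < (2 ^ p)%:R.
  apply: (@lt_le_trans _ _ p%:R); last by rewrite ler_nat ltnW // ltn_expl.
  exact: le_lt_trans (ler_norm _) (archi_boundP (normr_ge0 _)).
have := h p; rewrite leNgt => /negP; apply.
have e0 : 0 < 2 ^+ p :> R by rewrite exprn_gt0.
move: hp; rewrite natrX ltr_pdivrMr ?oppr_gt0 // -ltrBrDl sub0r ltr_pdivrMr //.
by rewrite mulrC.
Qed.

Definition alt_log m y : R := \sum_(k < m) (-1) ^+ k * y ^+ k.+1 / k.+1%:R.

Lemma is_derive_monomial (c : R) n y :
  is_derive y 1 (fun y => c * y ^+ n.+1) (c * (n.+1%:R * y ^+ n)).
Proof.
have h := is_deriveZ c (is_deriveX n.+1 (is_derive_id y (1 : R))).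
have e : (c \*: (id ^+ n.+1 : R -> R))%R = (fun y => c * y ^+ n.+1).
  by apply/funext => z /=; rewrite exprfctE.
rewrite -e; apply: (is_derive_eq h).
by rewrite /GRing.scale /= mulr1.
Qed.

Lemma is_derive_alt_log m y : is_derive y 1 (alt_log m) (\sum_(k < m) (- y) ^+ k).
Proof.
have -> : alt_log m = \sum_(k < m) (fun y => (-1) ^+ k / k.+1%:R * y ^+ k.+1).
  by apply/funext => z; rewrite fct_sumE; apply: eq_bigr => k _; rewrite mulrAC.
apply: is_derive_sum => k; apply: (is_derive_eq (is_derive_monomial _ _ _)).
have k0 : k.+1%:R != 0 :> R by rewrite pnatr_eq0.
by rewrite [in RHS]exprNn mulrA divfK.
Qed.

Lemma alt_log_approx m y : 0 <= y <= 1 ->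
  `|ln (1 + y) - alt_log m y| <= m.+1%:R^-1.
Proof.
move=> /andP[y0 y1].
have geo (z : R) : 0 <= z -> (1 + z)^-1 - \sum_(k < m) (- z) ^+ k = (- z) ^+ m / (1 + z).
  move=> z0; have z1 : 1 + z != 0 by rewrite gt_eqF //; lra.
  apply: (mulIf z1); rewrite mulrBl mulVf // divfK //.
  have := subrX1 (- z) m; lra.
pose D (s z : R) := s * (ln (1 + z) - alt_log m z).
have dD (s z : R) : 0 <= z -> is_derive z 1 (D s) (s * ((- z) ^+ m / (1 + z))).
  move=> z0; have l1 : is_derive (1 + z) 1 (@ln R) (1 + z)^-1.
    by apply: is_derive1_ln; lra.
  have l2 : is_derive z 1 (fun z => 1 + z) (1 : R).
    by apply: is_derive_eq; rewrite mulr1 add0r.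
  have l3 := @is_derive1_comp R (@ln R) (fun z => 1 + z) z _ _ l1 l2.
  have l4 := is_deriveZ s (is_deriveB l3 (is_derive_alt_log m z)).
  apply: (is_derive_eq l4).
  by rewrite /GRing.scale /= mulr1 geo.
have bound (s : R) : `|s| = 1 -> D s y - D s 0 <= m.+1%:R^-1.
  move=> s1.
  have : D s y - D s 0 <= m.+1%:R^-1 * y ^+ m.+1 - m.+1%:R^-1 * 0 ^+ m.+1.
    apply: (@ler_is_derive R (D s) (fun z => m.+1%:R^-1 * z ^+ m.+1)
      (fun z => s * ((- z) ^+ m / (1 + z)))
      (fun z => m.+1%:R^-1 * (m.+1%:R * z ^+ m)) 0 y y0) => z /andP[z0 _].
    - exact: dD.
    - exact: is_derive_monomial.
    rewrite mulKf ?pnatr_eq0 //; apply: (le_trans (ler_norm _)).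
    rewrite normrM s1 mul1r normrM normrX normrN normfV (ger0_norm z0) ger0_norm; last lra.
    by rewrite ler_pdivrMr ?ler_peMr ?exprn_ge0 //; lra.
  move=> h; apply: (le_trans h).
  rewrite expr0n mulr0 subr0 ler_piMr ?invr_ge0 //; exact: exprn_ile1.
have D0 (s : R) : D s 0 = 0.
  rewrite /D addr0 ln1 /alt_log big1 ?subrr ?mulr0 // => k _.
  by rewrite expr0n mulr0 mul0r.
have := bound 1 (normr1 R); have := bound (-1) (normrN1 R).
rewrite !D0 !subr0 /D mul1r mulN1r => h1 h2.
by rewrite ler_norml h2 andbT lerNl.
Qed.

Definition eta_series m x : R := \sum_(k < m) (-1) ^+ k / k.+1%:R ^+ 2 * expR (- (k.+1%:R * x)).

Lemma is_derive_eta_series m x :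
  is_derive x 1 (eta_series m) (- alt_log m (expR (- x))).
Proof.
have -> : eta_series m = \sum_(k < m)
    (fun x => (-1) ^+ k / k.+1%:R ^+ 2 * expR (- (k.+1%:R * x))).
  by apply/funext => z; rewrite fct_sumE.
rewrite /alt_log -sumrN; apply: is_derive_sum => k; apply: is_derive_eq.
have k0 : k.+1%:R != 0 :> R by rewrite pnatr_eq0.
rewrite /GRing.scale /= -expRM_natl (mulrN _ x).
by move: (expR (- (k.+1%:R * x))) (k.+1%:R : R) k0 => e u u0; field.
Qed.

Lemma sum_inv_sqr_le2 m : \sum_(k < m) k.+1%:R ^-2 <= 2 :> R.
Proof.
case: m => [|m]; first by rewrite big_ord0.
suff : \sum_(k < m.+1) k.+1%:R ^-2 <= 2 - m.+1%:R^-1 :> R.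
  have : 0 <= m.+1%:R^-1 :> R by rewrite invr_ge0.
  by move: (m.+1%:R^-1) (\sum_(_ < _) _) => u S; lra.
elim: m => [|m IH]; first by rewrite big_ord1 expr1n invr1; lra.
rewrite big_ord_recr /=.
have h : m.+2%:R^-2 <= m.+1%:R^-1 - m.+2%:R^-1 :> R.
  have u0 : 0 < m.+1%:R :> R by rewrite ltr0n.
  rewrite -(natr1 m.+1); move: m.+1%:R u0 => u u0.
  rewrite -subr_ge0 (_ : _ - _ = (u * (u + 1) ^+ 2)^-1); last by field; lra.
  by rewrite invr_ge0 mulr_ge0 ?exprn_ge0 //; lra.
by move: (m.+1%:R^-1) (m.+2%:R^-1) (m.+2%:R^-2) (\sum_(_ < _) _) IH h => u v w S; lra.
Qed.

Lemma eta_series_le m x : 0 <= x -> `|eta_series m x| <= 2 * expR (- x).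
Proof.
move=> x0; apply: (le_trans (ler_norm_sum _ _ _)).
apply: (@le_trans _ _ (\sum_(k < m) k.+1%:R ^-2 * expR (- x))).
  apply: ler_sum => k _.
  rewrite normrM normrM normrX normrN normr1 expr1n mul1r !ger0_norm ?expR_ge0 ?invr_ge0
    ?exprn_ge0 //.
  rewrite ler_wpM2l ?invr_ge0 ?exprn_ge0 // ler_expR lerN2 ler_peMl //.
  by rewrite ler1n.
by rewrite -mulr_suml ler_wpM2r ?expR_ge0 ?sum_inv_sqr_le2.
Qed.

Lemma soft_integral_bound (I : R -> R) x : 0 <= x -> I 0 = 0 ->
  (forall x, 0 <= x -> is_derive x 1 I (soft x)) ->
  `|I x - pi ^+ 2 / 12| <= 2 * expR (- x).
Proof.
move=> x0 I0 dI.
have approx (s : R) m : `|s| = 1 ->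
    s * (I x + eta_series m x - eta_series m 0) <= x / m.+1%:R.
  move=> s1; pose D z := s * (I z + eta_series m z).
  have : D x - D 0 <= m.+1%:R^-1 * x - m.+1%:R^-1 * 0.
    apply: (@ler_is_derive R D (fun z => m.+1%:R^-1 * z)
      (fun z => s * (soft z - alt_log m (expR (- z)))) (fun=> m.+1%:R^-1) 0 x x0) => z /andP[z0 _].
    - exact: (is_derive_eq (is_deriveZ s (is_deriveD (dI z z0) (is_derive_eta_series m z)))).
    - by apply: is_derive_eq; rewrite /GRing.scale /= ?mulr1.
    apply: (le_trans (ler_norm _)); rewrite normrM s1 mul1r.
    by apply: alt_log_approx; rewrite expR_ge0 -[leRHS]expR0 ler_expR oppr_le0.
  rewrite mulr0 subr0 mulrC; apply: le_trans.
  by rewrite /D I0 add0r -mulrBr.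
have {}approx m : `|I x + eta_series m x - eta_series m 0| <= x / m.+1%:R.
  have := approx 1 m (normr1 R); have := approx (-1) m (normrN1 R).
  by rewrite mul1r mulN1r => h1 h2; rewrite ler_norml h2 andbT lerNl.
rewrite -subr_ge0; apply: (@ge0_of_geometric _ (x + pi ^+ 2 / 8)) => p.
have h1 := approx (2 ^ p.+1)%N; have h2 := eta2_bound R p.
have h3 := eta_series_le (2 ^ p.+1) x0.
have e0 : eta_series (2 ^ p.+1) 0 = \sum_(k < 2 ^ p.+1) (-1) ^+ k / k.+1%:R ^+ 2.
  by apply: eq_bigr => k _; rewrite mulr0 oppr0 expR0 mulr1.
rewrite -e0 in h2.
have h4 : x / (2 ^ p.+1).+1%:R <= x / 2 ^+ p.
  rewrite ler_wpM2l // lef_pV2 ?posrE ?ltr0n ?exprn_gt0 // -natrX ler_nat.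
  by rewrite expnS mul2n -addnn; lia.
rewrite (mulrDl x) addrAC subr_ge0.
apply: (@le_trans _ _ (`|I x + eta_series (2 ^ p.+1) x - eta_series (2 ^ p.+1) 0| +
   `|eta_series (2 ^ p.+1) x| + `|eta_series (2 ^ p.+1) 0 - pi ^+ 2 / 12|)).
  rewrite (_ : I x - _ = (I x + eta_series (2 ^ p.+1) x - eta_series (2 ^ p.+1) 0)
    - eta_series (2 ^ p.+1) x + (eta_series (2 ^ p.+1) 0 - pi ^+ 2 / 12)); last ring.
  apply: (le_trans (ler_normD _ _)); rewrite lerD2r.
  by apply: (le_trans (ler_normB _ _)).
rewrite addrA [2 * _ + _]addrC; exact: lerD (lerD (le_trans h1 h4) h3) h2.
Qed.

Lemma exists_soft_primitive : exists2 I : R -> R, I 0 = 0 &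
  forall x, 0 <= x -> is_derive x 1 I (soft x).
Proof.
have [F dF] := @continuous_primitive R (@soft R) (-1) (@soft_continuous R).
exists (fun x => F x - F 0); first by rewrite subrr.
move=> x x0.
have := is_deriveB (dF x ltac:(lra)) (is_derive_cst (F 0) x (1 : R)).
by rewrite subr0.
Qed.

(* The logarithm of [pair_poly] at e^-s; [meanZ] and [varZ] below are minus its
   first derivative and its second derivative. *)
Definition logZ N s : R := 2 * \sum_(j < N) soft (j.*2.+1%:R * s).

Lemma expRN_le_sqr y : 0 < y -> expR (- y) <= 2 / y ^+ 2.
Proof.
move=> y0; rewrite expRN -[leRHS]invrK lef_pV2 ?posrE ?expR_gt0 ?invr_gt0 ?divr_gt0 ?exprn_gt0 //.
have := @expR_ge1Dxn R y 1 (ltW y0); rewrite invf_div.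
rewrite (_ : 2`!%:R = 2 :> R) //; lra.
Qed.

Lemma logZ_bound N s : 0 < s -> 1 <= 8 * N%:R * s ^+ 2 ->
  `|logZ N s - pi ^+ 2 / 12 / s| <= 65 * s.
Proof.
move=> s0 hN; have [I I0 dI] := exists_soft_primitive.
have mid : s * logZ N s <= I (N.*2%:R * s) <=
    s * logZ N s + (fermi 0 - fermi (N.*2%:R * s)) * s ^+ 2 / 2.
  rewrite /logZ; elim: (N) => [|n IH].
    by rewrite big_ord0 mul0r I0 subrr mulr0 !mul0r mulr0 addr0 lexx.
  rewrite big_ord_recr /=.
  have h : s <= n.*2.+1%:R * s by rewrite ler_peMl ?(ltW s0) // ler1n.
  have := midpoint_bounds (ltW s0) h dI.
  have -> : n.*2.+1%:R * s + s = n.+1.*2%:R * s.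
    by rewrite -[X in _ + X]mul1r -mulrDl natr1 doubleS.
  have -> : n.*2.+1%:R * s - s = n.*2%:R * s.
    by rewrite -[X in _ - X]mul1r -mulrBl -(natr1 n.*2) addrK.
  by move: IH; lra.
have Ns0 : 0 < N.*2%:R * s.
  rewrite mulr_gt0 // ltr0n double_gt0 lt0n; apply/eqP => N0.
  by move: hN; rewrite N0; lra.
have h2 := soft_integral_bound (ltW Ns0) I0 dI.
have h3 := expRN_le_sqr Ns0.
have h4 : 2 / (N.*2%:R * s) ^+ 2 <= 32 * s ^+ 2.
  rewrite ler_pdivrMr ?exprn_gt0 // -mul2n natrM.
  have -> : 32 * s ^+ 2 * (2 * N%:R * s) ^+ 2 = 2 * (8 * N%:R * s ^+ 2) ^+ 2 by ring.
  by rewrite ler_peMr // expr_ge1 //; lra.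
have h5 : 0 <= (fermi 0 - fermi (N.*2%:R * s)) * s ^+ 2 / 2 <= s ^+ 2 / 2.
  have := fermi_le (ltW Ns0); have := fermi_le1 (0 : R); have := fermi_gt0 (N.*2%:R * s).
  have := sqr_ge0 s; move: (s ^+ 2) => q q0 f1 f2 f3; nra.
have h6 : `|s * logZ N s - pi ^+ 2 / 12| <= 65 * s ^+ 2.
  by move: h2; rewrite !ler_norml; have := sqr_ge0 s; lra.
have -> : logZ N s - pi ^+ 2 / 12 / s = (s * logZ N s - pi ^+ 2 / 12) / s.
  by move: (pi ^+ 2 / 12 : R) (logZ N s) => A L; field; rewrite gt_eqF.
rewrite normrM normfV (gtr0_norm s0) ler_pdivrMr //.
by have -> : 65 * s * s = 65 * s ^+ 2 by ring.
Qed.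

End softplus_integral.


Section moments.
Variable R : realType.
Implicit Types x y t s h e a : R.

Definition meanZ N s : R := 2 * \sum_(j < N) j.*2.+1%:R * fermi (j.*2.+1%:R * s).
Definition varZ N s : R := 2 * \sum_(j < N) j.*2.+1%:R ^+ 2 *
  (fermi (j.*2.+1%:R * s) * (1 - fermi (j.*2.+1%:R * s))).

Lemma logZ_tangent N s y : logZ N s - meanZ N s * (y - s) <= logZ N y.
Proof.
rewrite /logZ /meanZ -mulrA -mulrBr ler_pM2l // mulr_suml -sumrB.
apply: ler_sum => j _; have := soft_tangent (j.*2.+1%:R * s) (j.*2.+1%:R * y).
by rewrite -mulrBr mulrA [fermi _ * _]mulrC.
Qed.

Lemma meanZ_tangent N s y : 0 <= s -> 0 <= y ->
  meanZ N s - varZ N s * (y - s) <= meanZ N y.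
Proof.
move=> s0 y0; rewrite /varZ /meanZ -mulrA -mulrBr ler_pM2l // mulr_suml -sumrB.
apply: ler_sum => j _; rewrite expr2 -2!mulrA -mulrBr ler_wpM2l //.
have := @fermi_tangent R (j.*2.+1%:R * s) (j.*2.+1%:R * y).
rewrite !mulr_ge0 // => /(_ isT isT).
by congr (_ - _ <= _); ring.
Qed.

Let A : R := pi ^+ 2 / 12.

Lemma pi_sqr_bounds : 1 / 3 <= A <= 4 / 3.
Proof.
rewrite /A; have := pihalf_ge1 R; have := pihalf_lt2 R => h1 h2.
by move: (pi : R) h1 h2 => p h1 h2; apply/andP; split; nra.
Qed.

(* The tangent inequality at s +/- s^2/2 squeezes the derivative between two
   difference quotients of [logZ]. *)
Lemma meanZ_bound N s : 0 < s <= 1 -> 1 <= 2 * N%:R * s ^+ 2 ->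
  `|meanZ N s - A / s ^+ 2| <= 391 / s.
Proof.
move=> /andP[s0 s1] hN; have /andP[A0 A1] := pi_sqr_bounds.
pose h := s ^+ 2 / 2.
have h0 : 0 < h by rewrite divr_gt0 ?exprn_gt0.
have hs : h <= s / 2 by rewrite /h ler_pM2r ?invr_gt0 // expr2 ler_piMl // ltW.
have n0 : 0 <= 8 * N%:R :> R by rewrite mulr_ge0.
have cond y : s / 2 <= y -> 1 <= 8 * N%:R * y ^+ 2.
  move=> sy; apply: (le_trans hN).
  have -> : 2 * N%:R * s ^+ 2 = 8 * N%:R * (s / 2) ^+ 2 by field.
  by rewrite ler_wpM2l // lerXn2r ?nnegrE //; lra.
have [c1 c2 c3] : [/\ s / 2 <= s, s / 2 <= s + h & s / 2 <= s - h] by split; lra.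
have [p2 p3] : 0 < s + h /\ 0 < s - h by split; lra.
have L0 := logZ_bound s0 (cond _ c1).
have Lp := logZ_bound p2 (cond _ c2).
have Lm := logZ_bound p3 (cond _ c3).
have tp := logZ_tangent N s (s + h); have tm := logZ_tangent N s (s - h).
have Ap : 0 <= A by lra.
have e1 : A / 2 - A * s / 4 <= A / s - A / (s + h).
  have -> : A / s - A / (s + h) = A / (2 + s).
    by rewrite /h; move: A => a; field; rewrite !gt_eqF //; nra.
  rewrite ler_pdivlMr; last lra.
  have -> : (A / 2 - A * s / 4) * (2 + s) = A - A * s ^+ 2 / 4 by field.
  by rewrite gerBl divr_ge0 // mulr_ge0 ?sqr_ge0.
have e2 : A / (s - h) - A / s <= A / 2 + A * s / 2.
  have -> : A / (s - h) - A / s = A / (2 - s).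
    by rewrite /h; move: A => a; field; rewrite !gt_eqF //; nra.
  rewrite ler_pdivrMr; last lra.
  have -> : (A / 2 + A * s / 2) * (2 - s) = A + A * (s * (1 - s)) / 2 by field.
  by rewrite lerDl divr_ge0 // mulr_ge0 // mulr_ge0 //; lra.
rewrite -(ler_pM2r h0) -{1}(gtr0_norm h0) -normrM mulrBl.
have -> : A / s ^+ 2 * h = A / 2 by rewrite /h; move: A => a; field; rewrite gt_eqF.
have -> : 391 / s * h = 391 * s / 2 by rewrite /h; field; rewrite gt_eqF.
move: L0 Lp Lm; rewrite -/A !ler_norml.
have As : A * s <= 4 / 3 * s by rewrite ler_wpM2r // ltW.
have As0 : 0 <= A * s by rewrite mulr_ge0 //; lra.
lra.
Qed.

Lemma inv_sqr_1D_le e : 0 < e -> (1 + e) ^-2 <= 1 - 2 * e + 4 * e ^+ 2.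
Proof.
move=> e0; have e1 : 0 < (1 + e) ^+ 2 by rewrite exprn_gt0 // addr_gt0.
rewrite -[leLHS]div1r ler_pdivrMr //.
have -> : (1 - 2 * e + 4 * e ^+ 2) * (1 + e) ^+ 2 =
  1 + (e ^+ 2 + 6 * e ^+ 3 + 4 * e ^+ 4) by ring.
by rewrite lerDl !addr_ge0 ?mulr_ge0 ?exprn_ge0 // ltW.
Qed.

Lemma inv_sqr_1B_le e : 0 < e <= 1 / 2 ->
  (1 - e) ^-2 <= 1 + 2 * e + 12 * e ^+ 2.
Proof.
move=> /andP[e0 e12]; have e1 : 0 < (1 - e) ^+ 2 by rewrite exprn_gt0 //; lra.
rewrite -[leLHS]div1r ler_pdivrMr //.
have -> : (1 + 2 * e + 12 * e ^+ 2) * (1 - e) ^+ 2 =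
  1 + e ^+ 2 * (9 - 22 * e + 12 * e ^+ 2) by ring.
by rewrite lerDl mulr_ge0 ?exprn_ge0 ?(ltW e0) //; nra.
Qed.

Lemma varZ_bound N s e : 0 < s <= 1 / 2 -> 0 < e <= 1 / 2 -> 2 <= N%:R * s ^+ 2 ->
  `|varZ N s * s ^+ 3 - 2 * A| <= 16 * e + 1200 * (s / e).
Proof.
move=> /andP[s0 s1] he hN; have /andP[A0 A1] := pi_sqr_bounds.
have /andP[e0 e1] := he.
have Ap : 0 <= A by lra.
have n0 : 0 <= 2 * N%:R :> R by rewrite mulr_ge0.
pose h := s * e.
have h0 : 0 < h by rewrite mulr_gt0.
have hs : h <= s / 2 by rewrite /h ler_pM2l // -div1r.
have [b1 b2 b3] : [/\ 0 < s <= 1, 0 < s + h <= 1 & 0 < s - h <= 1].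
  by clear -s0 s1 h0 hs; split; lra.
have [c1 c2 c3] : [/\ s / 2 <= s, s / 2 <= s + h & s / 2 <= s - h].
  by clear -s0 s1 h0 hs; split; lra.
have [s0' p0 m0] : [/\ 0 <= s, 0 <= s + h & 0 <= s - h].
  by clear -b1 b2 b3; split; lra.
have [e2 e3] : 0 < 1 + e /\ 0 < 1 - e by clear -e0 e1; split; lra.
have [e4 e5] : 1 <= 1 + e /\ 1 / 2 <= 1 - e by clear -e0 e1; split; lra.
have cond y : s / 2 <= y -> 1 <= 2 * N%:R * y ^+ 2.
  move=> sy; apply: (@le_trans _ _ (2 * N%:R * (s / 2) ^+ 2)).
    by clear -hN; lra.
  by rewrite ler_wpM2l // lerXn2r ?nnegrE //; clear -s0 sy; lra.
have M0 := meanZ_bound b1 (cond _ c1).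
have Mp := meanZ_bound b2 (cond _ c2).
have Mm := meanZ_bound b3 (cond _ c3).
have tp := meanZ_tangent N s0' p0.
have tm := meanZ_tangent N s0' m0.
have q0 : 0 < s ^+ 2 by rewrite exprn_gt0.
have rewp : (s + h) = s * (1 + e) by rewrite /h; ring.
have rewm : (s - h) = s * (1 - e) by rewrite /h; ring.
rewrite rewp in Mp; rewrite rewm in Mm.
have scale m u : 0 < u -> `|m - A / (s * u) ^+ 2| <= 391 / (s * u) ->
   `|m * s ^+ 2 - A / u ^+ 2| <= 391 / u * s.
  move=> u0 hm; have -> : m * s ^+ 2 - A / u ^+ 2 = (m - A / (s * u) ^+ 2) * s ^+ 2.
    by move: A => a; field; rewrite !gt_eqF.
  rewrite normrM (gtr0_norm q0).
  have -> : 391 / u * s = 391 / (s * u) * s ^+ 2 by field; rewrite !gt_eqF.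
  by rewrite ler_pM2r.
have {}Mp := scale _ (1 + e) e2 Mp.
have {}Mm := scale _ (1 - e) e3 Mm.
have {}M0 : `|meanZ N s * s ^+ 2 - A| <= 391 * s.
  by have := scale (meanZ N s) 1 ltr01; rewrite !mulr1 expr1n !divr1; exact.
have sp : (1 + e)^-1 * s <= s by rewrite mulrC ler_pdivrMr // ler_peMr.
have sm : (1 - e)^-1 * s <= 2 * s.
  by rewrite mulrC ler_pdivrMr // mulrAC ler_peMl //; clear -e5; lra.
have ep : A / (1 + e) ^+ 2 <= A * (1 - 2 * e + 4 * e ^+ 2).
  by rewrite ler_wpM2l // inv_sqr_1D_le.
have em : A / (1 - e) ^+ 2 <= A * (1 + 2 * e + 12 * e ^+ 2).
  by rewrite ler_wpM2l // inv_sqr_1B_le.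
set v := varZ N s * s ^+ 3.
have {}tp : meanZ N s * s ^+ 2 - v * e <= meanZ N (s * (1 + e)) * s ^+ 2.
  rewrite -(ler_pM2r q0) in tp; rewrite -rewp; apply: le_trans tp.
  by rewrite /v /h le_eqVlt; apply/orP; left; apply/eqP; ring.
have {}tm : meanZ N s * s ^+ 2 + v * e <= meanZ N (s * (1 - e)) * s ^+ 2.
  rewrite -(ler_pM2r q0) in tm; rewrite -rewm; apply: le_trans tm.
  by rewrite /v /h le_eqVlt; apply/orP; left; apply/eqP; ring.
rewrite -(ler_pM2r e0) -{1}(gtr0_norm e0) -normrM mulrBl.
have -> : (16 * e + 1200 * (s / e)) * e = 16 * e ^+ 2 + 1200 * s.
  by field; rewrite gt_eqF.
have eA : A * e ^+ 2 <= 4 / 3 * e ^+ 2 by rewrite ler_wpM2r // sqr_ge0.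
have eA0 : 0 <= A * e ^+ 2 by rewrite mulr_ge0 ?sqr_ge0.
move: Mp Mm M0; rewrite !ler_norml; move: (meanZ _ _ * _) (meanZ _ _ * _)
  (meanZ _ _ * _) tp tm => M1 M2 M3 tp tm.
move: (A / _) (A / _) ep em => A2 A3 ep em.
move: (1 + e)^-1 (1 - e)^-1 sp sm => A4 A5 sp sm.
clear -tp tm ep em sp sm eA eA0 s0; lra.
Qed.

Lemma sum_expRN_odd_le N s : 0 < s ->
  \sum_(j < N) expR (- (j.*2.+1%:R * s)) <= s^-1.
Proof.
move=> s0.
have step : 2 * s <= expR s - expR (- s) by apply: expR_sinh_ineq; exact: ltW.
suff h : 2 * s * \sum_(j < N) expR (- (j.*2.+1%:R * s)) <= 1 - expR (- (N.*2%:R * s)).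
  rewrite -[leRHS]div1r ler_pdivlMr // mulrC.
  have := expR_ge0 (- (N.*2%:R * s)); nra.
elim: N => [|N IH].
  by rewrite big_ord0 mulr0 mul0r oppr0 expR0 subrr.
rewrite big_ord_recr /= mulrDr doubleS.
set x := expR (- (N.*2.+1%:R * s)).
have e1 : expR (- (N.*2%:R * s)) = x * expR s.
  by rewrite /x -expRD -natr1; congr expR; ring.
have e2 : expR (- (N.*2.+2%:R * s)) = x * expR (- s).
  by rewrite /x -expRD -natr1; congr expR; ring.
have : 2 * s * x <= (expR s - expR (- s)) * x by rewrite ler_wpM2r // expR_ge0.
by move: IH; rewrite e1 e2; lra.
Qed.

Lemma expRN_moment k a s : 0 <= a -> 0 < s ->
  a ^+ k.+1 * expR (- (a * s)) <= k.+1`!%:R * (2 / s) ^+ k.+1 * expR (- (a * (s / 2))).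
Proof.
move=> a0 s0; have as0 : 0 <= a * (s / 2) by rewrite mulr_ge0 // divr_ge0 // ltW.
have := expR_ge1Dxn k as0.
have f0 : 0 < k.+1`!%:R :> R by rewrite ltr0n fact_gt0.
have -> : expR (- (a * s)) = expR (- (a * (s / 2))) * expR (- (a * (s / 2))).
  by rewrite -expRD; congr expR; field.
move=> h; rewrite [leLHS]mulrA ler_pM2r ?expR_gt0 //.
have {}h : (a * (s / 2)) ^+ k.+1 / k.+1`!%:R <= expR (a * (s / 2)) by lra.
rewrite expRN ler_pdivrMr ?expR_gt0 //.
have pq : (2 / s) ^+ k.+1 * (s / 2) ^+ k.+1 = 1.
  by rewrite -exprMn mulrA divfK ?gt_eqF // divff // expr1n.
have -> : a ^+ k.+1 = k.+1`!%:R * (2 / s) ^+ k.+1 * ((a * (s / 2)) ^+ k.+1 / k.+1`!%:R).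
  rewrite [(a * _) ^+ _]exprMn; move: (a ^+ _) ((2 / s) ^+ _) ((s / 2) ^+ _) pq => u v w pq.
  move: (_`!%:R) f0 => f f0; rewrite -[LHS]mulr1 -pq.
  by field; rewrite gt_eqF.
by rewrite ler_wpM2l // mulr_ge0 ?ler0n // exprn_ge0 // divr_ge0 // ltW.
Qed.

Lemma sum_expRN_moment_le k N s : 0 < s ->
  \sum_(j < N) j.*2.+1%:R ^+ k.+1 * expR (- (j.*2.+1%:R * s)) <=
  k.+1`!%:R * (2 / s) ^+ k.+2.
Proof.
move=> s0; apply: (@le_trans _ _ (\sum_(j < N) k.+1`!%:R * (2 / s) ^+ k.+1 *
    expR (- (j.*2.+1%:R * (s / 2))))).
  by apply: ler_sum => j _; apply: expRN_moment.
rewrite -mulr_sumr [_ ^+ k.+2]exprSr [leRHS]mulrA; apply: ler_wpM2l.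
  by rewrite mulr_ge0 ?ler0n // exprn_ge0 // divr_ge0 // ltW.
by rewrite -[2 / s]invf_div; apply: sum_expRN_odd_le; rewrite divr_gt0.
Qed.

End moments.


(** * The characteristic function *)

Section characteristic_function.
Variable R : realType.
Implicit Types (x y t p u : R) (z w : R[i]).
Local Open Scope complex_scope.

Lemma normc_leD z w : normc (z + w) <= normc z + normc w.
Proof. exact: le_normcD. Qed.

Lemma normc_prod (I : Type) (s : seq I) (F : I -> R[i]) :
  normc (\prod_(i <- s) F i) = \prod_(i <- s) normc (F i).
Proof. by elim/big_rec2: _ => [|i u z _ <-]; rewrite ?normc1 ?normcM. Qed.

Lemma Re_le_normc z : `|complex.Re z| <= normc z.
Proof.
case: z => a b /=; rewrite -sqrtr_sqr ler_sqrt ?addr_ge0 ?sqr_ge0 //.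
by rewrite lerDl sqr_ge0.
Qed.

Lemma normc_le_sum z : normc z <= `|complex.Re z| + `|complex.Im z|.
Proof.
case: z => a b /=; rewrite -[leRHS]ger0_norm ?addr_ge0 // -sqrtr_sqr.
rewrite ler_sqrt ?sqr_ge0 // sqrrD -!normrX !(ger0_norm (sqr_ge0 _)).
by rewrite [leRHS]addrAC lerDl mulrn_wge0 // mulr_ge0.
Qed.

Lemma normc_real x : normc x%:C = `|x|.
Proof. by rewrite /= expr0n addr0 sqrtr_sqr. Qed.

Lemma normc_ge0 z : 0 <= normc z.
Proof. by case: z => a b; rewrite sqrtr_ge0. Qed.

Lemma dist_prod_le n (F G : 'I_n -> R[i]) :
  (forall i, normc (F i) <= 1) -> (forall i, normc (G i) <= 1) ->
  normc (\prod_i F i - \prod_i G i) <= \sum_i normc (F i - G i).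
Proof.
elim: n F G => [|n IH] F G hF hG; first by rewrite !big_ord0 subrr normc0.
rewrite !big_ord_recl.
have split4 (a b c d : R[i]) : a * b - c * d = (a - c) * d + a * (b - d) by ring.
rewrite split4; apply: (le_trans (normc_leD _ _)); rewrite !normcM; apply: lerD.
  rewrite ler_piMr ?normc_ge0 // normc_prod.
  by apply: prodr_ile1 => i; rewrite normc_ge0 hG.
apply: (@le_trans _ _ (1 * \sum_i normc (F (lift ord0 i) - G (lift ord0 i)))).
  by apply: ler_pM; rewrite ?normc_ge0 // IH.
by rewrite mul1r.
Qed.

Definition cis x : R[i] := cos x +i* sin x.

Lemma cisD x y : cis (x + y) = cis x * cis y.
Proof.
rewrite /cis cosD sinD; apply/eqP; rewrite eq_complex /= eqxx /=.
by rewrite addrC eqxx.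
Qed.

Lemma cis0 : cis 0 = 1.
Proof. by rewrite /cis cos0 sin0. Qed.

Lemma cisMn n x : cis (n%:R * x) = cis x ^+ n.
Proof.
elim: n => [|n IH]; first by rewrite mul0r cis0 expr0.
by rewrite -natr1 mulrDl mul1r cisD IH exprSr.
Qed.

Lemma normc_cis x : normc (cis x) = 1.
Proof. by rewrite /= cos2Dsin2 sqrtr1. Qed.

Lemma cis_taylor x : normc (cis x - ((1 - x ^+ 2 / 2) +i* x)) <= `|x| ^+ 3.
Proof.
apply: (le_trans (normc_le_sum _)); rewrite /=.
have := cos_taylor x; have := sin_taylor x.
have -> : cos x - (1 - x ^+ 2 / 2) = cos x - 1 + x ^+ 2 / 2 by ring.
have : 0 <= `|x| ^+ 3 by rewrite exprn_ge0.
lra.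
Qed.

Lemma cis_dist1 x : normc (cis x - 1) <= 2 * `|x|.
Proof.
apply: (le_trans (normc_le_sum _)); rewrite /= oppr0 addr0.
wlog x0 : x / 0 <= x.
  move=> h; have [/h //|/ltW x0] := leP 0 x.
  by have := h (- x); rewrite oppr_ge0 cosN sinN !normrN; apply.
rewrite (ger0_norm x0) distrC ger0_norm ?subr_ge0 ?cos_le1 //.
have h1 := subr_cos_le x0; have h2 := sin_le x0.
have h3 : - sin x <= x.
  have : - sin x - - sin 0 <= x - 0.
    apply: (@ler_is_derive R (fun y => - sin y) id (fun y => - cos y) (fun=> 1)) => // y _.
  by rewrite sin0; lra.
have : `|sin x| <= x by rewrite ler_norml h2 lerNl h3.
lra.
Qed.

(* Characteristic function of a centred Bernoulli(p) variable. *)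
Definition osc p x : R[i] := (1 - p)%:C * cis (- (p * x)) + p%:C * cis ((1 - p) * x).

Lemma osc_factor p x : (1 - p)%:C + p%:C * cis x = cis (p * x) * osc p x.
Proof.
rewrite /osc mulrDr mulrCA -cisD subrr cis0 mulr1 mulrCA -cisD.
by congr (_ + _ * cis _); ring.
Qed.

Lemma normc_osc_sqr p x : normc (osc p x) ^+ 2 = 1 - 2 * (p * (1 - p)) * (1 - cos x).
Proof.
have -> : normc (osc p x) = normc ((1 - p)%:C + p%:C * cis x).
  by rewrite osc_factor normcM normc_cis mul1r.
rewrite /= sqr_sqrtr ?addr_ge0 ?sqr_ge0 // !mul0r subr0 addr0 add0r.
have h := sin2cos2 x.
rewrite [(p * sin x) ^+ 2]exprMn h; ring.
Qed.

Lemma normc_osc_le1 p x : 0 <= p <= 1 -> normc (osc p x) <= 1.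
Proof.
move=> /andP[p0 p1]; rewrite -(@ler_pXn2r _ 2) ?nnegrE ?normc_ge0 // normc_osc_sqr expr1n.
by rewrite gerBl mulr_ge0 ?mulr_ge0 ?subr_ge0 ?cos_le1.
Qed.

Lemma expRN_dist u : 0 <= u -> `|1 - u - expR (- u)| <= u ^+ 2.
Proof.
move=> u0; rewrite distrC ger0_norm; last by rewrite subr_ge0 expR_ge1Dx.
have u1 : 0 < 1 + u by lra.
have : expR (- u) <= (1 + u)^-1.
  by rewrite expRN lef_pV2 ?posrE ?expR_gt0 // expR_ge1Dx.
have -> : (1 + u)^-1 = 1 - u + u ^+ 2 / (1 + u) by field; rewrite gt_eqF.
have : u ^+ 2 / (1 + u) <= u ^+ 2.
  by rewrite ler_pdivrMr // ler_peMr ?sqr_ge0 // lerDl.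
lra.
Qed.

Lemma osc_gauss p x : 0 <= p <= 1 ->
  normc (osc p x - (expR (- (p * (1 - p) * x ^+ 2 / 2)))%:C) <= p * (`|x| ^+ 3 + `|x| ^+ 4).
Proof.
move=> /andP[p0 p1]; have q0 : 0 <= 1 - p by rewrite subr_ge0.
set u := p * (1 - p) * x ^+ 2 / 2.
pose T (y : R) : R[i] := (1 - y ^+ 2 / 2) +i* y.
have -> : osc p x - (expR (- u))%:C =
   ((1 - p)%:C * (cis (- (p * x)) - T (- (p * x))) +
    p%:C * (cis ((1 - p) * x) - T ((1 - p) * x))) + (1 - u - expR (- u))%:C.
  have -> : (1 - u - expR (- u))%:C = (1 - u)%:C - (expR (- u))%:C by rewrite rmorphB.
  have -> : (1 - u)%:C = (1 - p)%:C * T (- (p * x)) + p%:C * T ((1 - p) * x).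
    by apply/eqP; rewrite eq_complex /= /u; apply/andP; split; apply/eqP; field.
  by rewrite /osc; ring.
apply: (le_trans (normc_leD _ _)); rewrite [leRHS]mulrDr; apply: lerD.
  apply: (le_trans (normc_leD _ _)); rewrite !normcM !normc_real (ger0_norm p0) (ger0_norm q0).
  have h1 := cis_taylor (- (p * x)); have h2 := cis_taylor ((1 - p) * x).
  apply: (@le_trans _ _ ((1 - p) * `|- (p * x)| ^+ 3 + p * `|(1 - p) * x| ^+ 3)).
    by apply: lerD; apply: ler_wpM2l.
  rewrite normrN !normrM (ger0_norm p0) (ger0_norm q0) !exprMn.
  have -> : (1 - p) * (p ^+ 3 * `|x| ^+ 3) + p * ((1 - p) ^+ 3 * `|x| ^+ 3) =
    (p * `|x| ^+ 3) * ((1 - p) * (1 - 2 * (p * (1 - p)))) by ring.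
  rewrite ler_piMr ?mulr_ge0 ?exprn_ge0 //.
  have : 0 <= p * (1 - p) by rewrite mulr_ge0.
  by nra.
rewrite normc_real; apply: (@le_trans _ _ (u ^+ 2)).
  by apply: expRN_dist; rewrite /u divr_ge0 // mulr_ge0 ?sqr_ge0 // mulr_ge0.
have -> : u ^+ 2 = (p * `|x| ^+ 4) * (p * (1 - p) ^+ 2 / 4).
  have -> : `|x| ^+ 4 = (x ^+ 2) ^+ 2 by rewrite -normrX ger0_norm -?exprM // exprn_even_ge0.
  by rewrite /u; field.
rewrite ler_piMr ?mulr_ge0 ?exprn_ge0 //; nra.
Qed.

End characteristic_function.


Section wave.
Variable R : realType.
Implicit Types (t th v : R) (N : nat).
Local Open Scope complex_scope.

Local Notation odd_nat j := (j.*2.+1%:R : R).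

(* [char_fun] squared is the characteristic function of the centred weight, and
   [wave N t v th] the real part of E e^(i th (X - v)) for the weight X. *)
Definition char_fun N t th : R[i] :=
  \prod_(j < N) osc (fermi (odd_nat j * t)) (odd_nat j * th).

Definition wave N t v th : R :=
  complex.Re (cis ((meanZ N t - v) * th) * char_fun N t th ^+ 2).

Lemma fermi01 t : 0 <= fermi t <= 1.
Proof. by rewrite fermi_le1 ltW ?fermi_gt0. Qed.

Lemma expR_soft t : 1 + expR (- t) = expR (soft t).
Proof. by rewrite /soft lnK // posrE onepexp_gt0. Qed.

Lemma cis_sum (I : Type) (s : seq I) (F : I -> R) :
  cis (\sum_(i <- s) F i) = \prod_(i <- s) cis (F i).
Proof. by elim/big_rec2: _ => [|i u z _ <-]; rewrite ?cis0 ?cisD. Qed.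

Lemma odd_prod_polar N t th :
  \prod_(j < N) (1 + ((expR (- t))%:C * cis th) ^+ (j.*2.+1)) =
  (expR (\sum_(j < N) soft (odd_nat j * t)))%:C *
  (cis (\sum_(j < N) odd_nat j * fermi (odd_nat j * t) * th) * char_fun N t th).
Proof.
rewrite /char_fun cis_sum expR_sum -big_split /= rmorph_prod -big_split /=.
apply: eq_bigr => j _.
have -> : odd_nat j * fermi (odd_nat j * t) * th = fermi (odd_nat j * t) * (odd_nat j * th).
  by rewrite mulrA [fermi _ * _]mulrC.
rewrite -osc_factor -expR_soft exprMn -cisMn -rmorphXn /= -expRM_natl mulrN.
set y := odd_nat j * t; have := expR_gt0 y => y0.
have e1 : (1 + expR (- y)) * (1 - fermi y) = 1.
  by rewrite -fermiN /fermi divff // gt_eqF // onepexp_gt0.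
have e2 : (1 + expR (- y)) * fermi y = expR (- y).
  by rewrite -[RHS](addKr 1) addrC -{2}e1; ring.
by rewrite mulrDr mulrA -!rmorphM e1 e2.
Qed.

Lemma horner_pair_poly_polar N t th :
  (map_poly (real_complex R) (pair_poly R N)).[(expR (- t))%:C * cis th] =
  (expR (logZ N t))%:C * (cis (meanZ N t * th) * char_fun N t th ^+ 2).
Proof.
rewrite /pair_poly rmorphXn /= horner_exp /odd_prod rmorph_prod horner_prod.
have -> : \prod_(j < N) (map_poly (real_complex R) (1 + 'X^(j.*2.+1))).[(expR (- t))%:C * cis th] =
   \prod_(j < N) (1 + ((expR (- t))%:C * cis th) ^+ (j.*2.+1)).
  by apply: eq_bigr => j _; rewrite rmorphD /= rmorph1 map_polyXn hornerD hornerXn hornerC.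
rewrite odd_prod_polar !exprMn; congr (_ * (_ * _)).
  by rewrite -rmorphXn /= -expRM_natl.
by rewrite -cisMn /meanZ -mulr_suml mulrA.
Qed.

Lemma Re_realM (x : R) (z : R[i]) : complex.Re (x%:C * z) = x * complex.Re z.
Proof. by case: z => a b /=; rewrite mul0r subr0. Qed.

Lemma wave_sum N m t v th : (size (pair_poly R N) <= m)%N ->
  \sum_(k < m)
     (pair_poly R N)`_k * expR (- (k%:R * t)) * cos ((k%:R - v) * th) =
  expR (logZ N t) * wave N t v th.
Proof.
move=> sm; have := horner_pair_poly_polar N t th.
rewrite (@horner_coef_wide _ m) ?(leq_trans (size_poly _ _)) // => /(congr1 (fun z =>
  cis (- (v * th)) * z)).
have -> (x y z w : R[i]) : x * (y * (z * w)) = y * ((x * z) * w) by ring.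
rewrite -cisD (_ : - (v * th) + _ = (meanZ N t - v) * th); last by ring.
move/(congr1 (@complex.Re R)).
rewrite Re_realM -/(wave N t v th).
move=> <-; rewrite mulr_sumr raddf_sum /=; apply: eq_bigr => k _.
rewrite coef_map /= exprMn -cisMn -rmorphXn /= -expRM_natl mulrN.
by rewrite cosN sinN mulrBl cosB; ring.
Qed.

Lemma char_fun_norm N t th :
  normc (char_fun N t th ^+ 2) =
  \prod_(j < N) normc (osc (fermi (odd_nat j * t)) (odd_nat j * th)) ^+ 2.
Proof. by rewrite expr2 normcM -expr2 /char_fun normc_prod prodrXl. Qed.

Lemma fermi_var_ge t : 0 <= t -> expR (- t) / 4 <= fermi t * (1 - fermi t).
Proof.
move=> t0; rewrite -fermiN /fermi expRN; have := expR_ge1Dx t.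
move: (expR t) => e he; have e1 : 1 <= e by lra.
have e0 : 0 < e by lra.
have -> : (1 + e)^-1 * (1 + e^-1)^-1 = e / (1 + e) ^+ 2.
  by field; rewrite !gt_eqF // addr_gt0.
have -> : e^-1 / 4 = e / (2 * e) ^+ 2 by field; rewrite gt_eqF.
rewrite ler_wpM2l ?(ltW e0) // lef_pV2 ?posrE ?exprn_gt0 ?addr_gt0 ?mulr_gt0 //.
by rewrite lerXn2r ?nnegrE //; lra.
Qed.

Lemma wave_bound N t v th : 0 <= t ->
  `|wave N t v th| <=
  expR (- ((\sum_(j < N) expR (- (odd_nat j * t)) * (1 - cos (odd_nat j * th))) / 2)).
Proof.
move=> t0; apply: (le_trans (Re_le_normc _)).
rewrite normcM normc_cis mul1r char_fun_norm mulr_suml -sumrN expR_sum.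
apply: ler_prod => j _; rewrite sqr_ge0 /=.
rewrite normc_osc_sqr; apply: (le_trans _ (expR_ge1Dx _)); rewrite lerD2l lerN2.
have h : 0 <= odd_nat j * t by rewrite mulr_ge0.
rewrite mulrAC; apply: ler_wpM2r; first by rewrite subr_ge0 cos_le1.
by have := fermi_var_ge h; lra.
Qed.

Lemma wave_gauss N t v th : 0 <= t ->
  `|wave N t v th - expR (- (varZ N t * th ^+ 2 / 2))| <=
  2 * `|(meanZ N t - v) * th| +
  2 * \sum_(j < N) expR (- (odd_nat j * t)) * (`|odd_nat j * th| ^+ 3 + `|odd_nat j * th| ^+ 4).
Proof.
move=> t0; set g := expR _.
set p := fun j : nat => fermi (odd_nat j * t).
set G := \prod_(j < N) (expR (- (p j * (1 - p j) * (odd_nat j * th) ^+ 2 / 2)))%:C.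
have gG : g%:C = G ^+ 2.
  rewrite /G -rmorph_prod -rmorphXn -expR_sum /= -expRM_natl; congr (expR _)%:C.
  rewrite /varZ mulr_sumr !mulr_suml -sumrN mulr_sumr; apply: eq_bigr => j _.
  by rewrite /p; move: (fermi _) => q; field.
have f1 i : normc (osc (p i) (odd_nat i * th)) <= 1 by apply/normc_osc_le1/fermi01.
have g1 (i : 'I_N) : normc ((expR (- (p i * (1 - p i) * (odd_nat i * th) ^+ 2 / 2)))%:C) <= 1.
  rewrite normc_real ger0_norm ?expR_ge0 // -[leRHS]expR0 ler_expR oppr_le0.
  have /andP[p0 p1] := fermi01 (odd_nat i * t).
  by rewrite divr_ge0 // mulr_ge0 ?sqr_ge0 // mulr_ge0 // subr_ge0.
set Fi := char_fun N t th.
have nF : normc Fi <= 1.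
  by rewrite /Fi /char_fun normc_prod; apply: prodr_ile1 => i; rewrite normc_ge0 f1.
have nG : normc G <= 1.
  by rewrite /G normc_prod; apply: prodr_ile1 => i; rewrite normc_ge0 g1.
have -> : wave N t v th - g = complex.Re ((cis ((meanZ N t - v) * th) - 1) * Fi ^+ 2
   + (Fi + G) * (Fi - G)).
  have -> : (cis ((meanZ N t - v) * th) - 1) * Fi ^+ 2 + (Fi + G) * (Fi - G) =
    cis ((meanZ N t - v) * th) * Fi ^+ 2 - g%:C by rewrite gG; ring.
  by rewrite raddfB.
apply: (le_trans (Re_le_normc _)); apply: (le_trans (normc_leD _ _)).
rewrite !normcM; apply: lerD.
  apply: (le_trans _ (cis_dist1 _)); rewrite ler_piMr ?normc_ge0 //.
  by rewrite mulr_ile1 ?normc_ge0.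
apply: ler_pM; rewrite ?normc_ge0 //.
  by apply: (le_trans (normc_leD _ _)); lra.
apply: (le_trans (dist_prod_le (fun i : 'I_N => f1 i) g1)).
apply: ler_sum => j _; apply: (le_trans (osc_gauss _ (fermi01 _))).
by apply: ler_wpM2r; [rewrite addr_ge0 // exprn_ge0|exact: fermi_le_expRN].
Qed.

End wave.


Section domination.
Variable R : realType.
Implicit Types (t th v r : R) (N : nat).

Local Notation odd_nat j := (j.*2.+1%:R : R).

(* The factor on the left is |1 - q^2|^2 for q = r e^(i th). *)
Lemma sum_geometric_cos N r th :
  ((1 - r ^+ 2) ^+ 2 + 4 * r ^+ 2 * sin th ^+ 2) *
    \sum_(j < N) r ^+ j.*2.+1 * cos (odd_nat j * th) =
  r * (1 - r ^+ 2) * cos th -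
  r ^+ N.*2.+1 * (cos (odd_nat N * th) - r ^+ 2 * cos (odd_nat N * th - 2 * th)).
Proof.
elim: N => [|N IH].
  rewrite big_ord0 mulr0 mul1r (_ : th - 2 * th = - th); last by ring.
  by rewrite cosN; ring.
rewrite big_ord_recr /= mulrDr IH doubleS.
have -> : N.*2.+3%:R * th - 2 * th = odd_nat N * th.
  by rewrite -(natr1 N.*2.+2) -(natr1 N.*2.+1); ring.
have -> : N.*2.+3%:R * th = odd_nat N * th + 2 * th.
  by rewrite -(natr1 N.*2.+2) -(natr1 N.*2.+1); ring.
rewrite cosB cosD.
have c2 : cos (2 * th) = 1 - 2 * sin th ^+ 2.
  rewrite (_ : 2 * th = th *+ 2); last by rewrite mulr_natl.
  by rewrite cos_mulr2n cos2sin2; ring.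
by rewrite c2 !exprS; ring.
Qed.

Lemma sum_geometric_odd r m d :
  (1 - r ^+ 2) * \sum_(j < d) r ^+ (m + j).*2.+1 =
  r ^+ m.*2.+1 - r ^+ (m + d).*2.+1.
Proof.
elim: d => [|d IH]; first by rewrite big_ord0 mulr0 addn0 subrr.
by rewrite big_ord_recr /= mulrDr IH addnS doubleS !exprS; ring.
Qed.

Lemma expRN_double_le N t : 0 < t -> 2 <= N%:R * t ^+ 2 ->
  expR (- (N.*2%:R * t)) <= t ^+ 2 / 8.
Proof.
move=> t0 hN; have Nt0 : 0 < N.*2%:R * t.
  rewrite mulr_gt0 // ltr0n double_gt0 lt0n; apply/eqP => N0.
  by move: hN; rewrite N0 mul0r; lra.
apply: (le_trans (expRN_le_sqr Nt0)); rewrite ler_pdivrMr ?exprn_gt0 //.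
have -> : t ^+ 2 / 8 * (N.*2%:R * t) ^+ 2 = (N%:R * t ^+ 2) ^+ 2 / 2.
  by rewrite -mul2n natrM; field.
nra.
Qed.

Lemma osc_sum_ge N t th : 0 < t <= 1 / 2 -> 2 <= N%:R * t ^+ 2 -> `|th| <= pi ->
  th ^+ 2 / (4 * t * (36 * t ^+ 2 + th ^+ 2)) - 1 <=
  \sum_(j < N) expR (- (odd_nat j * t)) * (1 - cos (odd_nat j * th)).
Proof.
move=> /andP[t0 t1] hN hth.
pose r := expR (- t).
have er k : expR (- (k%:R * t)) = r ^+ k by rewrite /r -expRM_natl mulrN.
under eq_bigr do rewrite er mulrBr mulr1.
rewrite sumrB.
have r0 : 0 < r by rewrite expR_gt0.
have t0' := ltW t0; have r0' := ltW r0.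
have r1 : r < 1 by rewrite -expR0 ltr_expR oppr_lt0.
have rh : 1 / 2 <= r by have := expR_ge1Dx (- t); rewrite -/r; clear -t1; lra.
set w := 1 - r ^+ 2.
have w2 : w <= 2 * t.
  have := expR_ge1Dx (- (2%:R * t)); rewrite er /w; clear; lra.
have w1 : t <= w.
  have h : r ^+ 2 <= (1 + 2 * t)^-1.
    rewrite -er expRN lef_pV2 ?posrE ?expR_gt0 ?expR_ge1Dx //; clear -t0; lra.
  have : (1 + 2 * t)^-1 <= 1 - t.
    rewrite -[leLHS]div1r ler_pdivrMr; last by clear -t0; lra.
    have : 0 <= t * (1 - 2 * t) by rewrite mulr_ge0 ?(ltW t0) //; clear -t1; lra.
    clear; nra.
  rewrite /w; clear -h; lra.
have w0 : 0 < w := lt_le_trans t0 w1.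
have r1' := ltW r1; have w0' := ltW w0.
set D := w ^+ 2 + 4 * r ^+ 2 * sin th ^+ 2.
have D1 : t ^+ 2 <= D.
  apply: (@le_trans _ _ (w ^+ 2)); first by rewrite lerXn2r ?nnegrE.
  by rewrite lerDl mulr_ge0 ?sqr_ge0 // mulr_ge0 ?sqr_ge0.
have D0 : 0 < D by apply: lt_le_trans D1; rewrite exprn_gt0.
have D0' := ltW D0.
have rN : r ^+ N.*2.+1 <= t ^+ 2 / 8.
  rewrite exprS; apply: (@le_trans _ _ (r ^+ N.*2)).
    by rewrite ler_piMl ?exprn_ge0.
  by rewrite -er expRN_double_le.
have rN0 : 0 <= r ^+ N.*2.+1 by rewrite exprn_ge0.
have eqS : (1 - r ^+ 2) * \sum_(j < N) r ^+ j.*2.+1 = r - r ^+ N.*2.+1.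
  exact: (sum_geometric_odd r 0 N).
have eqC := sum_geometric_cos N r th.
rewrite -/w -/D in eqS eqC.
set S := \sum_(j < N) _ in eqS *; set C := \sum_(j < N) _ in eqC *.
have S1 : r / w - 1 / 8 <= S.
  have -> : S = (r - r ^+ N.*2.+1) / w by rewrite -eqS mulrC mulKf // gt_eqF.
  rewrite mulrBl lerD2l lerN2 ler_pdivrMr //; apply: (le_trans rN).
  have : t ^+ 2 <= t * w by rewrite expr2 ler_pM2l.
  have : t * w <= w by rewrite ler_piMl ?(ltW w0) //; clear -t1; lra.
  clear; lra.
have C1 : C <= r * w * cos th / D + 1 / 4.
  have -> : C = (r * w * cos th - r ^+ N.*2.+1 *
      (cos (odd_nat N * th) - r ^+ 2 * cos (odd_nat N * th - 2 * th))) / D.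
    by rewrite -eqC mulrC mulKf // gt_eqF.
  rewrite mulrBl lerD2l -mulNr ler_pdivrMr //.
  apply: (@le_trans _ _ (r ^+ N.*2.+1 * 2)).
    rewrite -mulrN ler_wpM2l //.
    have c1 := cos_geN1 (odd_nat N * th); have c2 := cos_le1 (odd_nat N * th - 2 * th).
    have : r ^+ 2 * cos (odd_nat N * th - 2 * th) <= 1.
      apply: (@le_trans _ _ (r ^+ 2 * 1)); first by rewrite ler_wpM2l ?sqr_ge0.
      by rewrite mulr1 expr_le1.
    by clear -c1; lra.
  by clear -rN D1; lra.
suff main : th ^+ 2 / (4 * t * (36 * t ^+ 2 + th ^+ 2)) - 1 / 2 <= r / w - r * w * cos th / D.
  by clear -main S1 C1; lra.
have rw : (4 * t)^-1 <= r / w.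
  rewrite ler_pdivlMr // mulrC ler_pdivrMr ?mulr_gt0 //.
  have : 2 * w <= 4 * t by clear -w2; lra.
  have : 4 * t * (1 / 2) <= 4 * t * r by rewrite ler_wpM2l // mulr_ge0.
  by clear -w2; lra.
have den : 0 < 36 * t ^+ 2 + th ^+ 2.
  by rewrite ltr_wpDr ?sqr_ge0 // mulr_gt0 ?exprn_gt0.
have split4 : th ^+ 2 / (4 * t * (36 * t ^+ 2 + th ^+ 2)) =
   (4 * t)^-1 * (th ^+ 2 / (36 * t ^+ 2 + th ^+ 2)).
  by rewrite invfM mulrCA.
have frac1 : th ^+ 2 / (36 * t ^+ 2 + th ^+ 2) <= 1.
  by rewrite ler_pdivrMr // mul1r lerDr mulr_ge0 ?sqr_ge0.
have frac0 : 0 <= th ^+ 2 / (36 * t ^+ 2 + th ^+ 2) by rewrite divr_ge0 ?sqr_ge0 ?(ltW den).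
suff main : (4 * t)^-1 * (th ^+ 2 / (36 * t ^+ 2 + th ^+ 2)) <= r / w - r * w * cos th / D.
  by rewrite split4; clear -main; lra.
have [c0|c0] := leP (cos th) 0.
  apply: (@le_trans _ _ (r / w)).
    by rewrite -[leRHS]mulr1; apply: ler_pM; rewrite // invr_ge0 mulr_ge0.
  by rewrite lerBrDl gerDr mulr_le0_ge0 ?invr_ge0 ?(ltW D0) // mulr_ge0_le0 // mulr_ge0.
have fr : w ^+ 2 / D <= 1 - th ^+ 2 / (36 * t ^+ 2 + th ^+ 2).
  have s3 : th ^+ 2 / 9 <= sin th ^+ 2.
    have hs (y : R) : 0 <= y -> y <= pi -> 0 < cos y -> y ^+ 2 / 9 <= sin y ^+ 2.
      move=> y0 ypi cy.
      have yp2 : y <= pi / 2.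
        rewrite leNgt; apply/negP => hy; move: cy; rewrite ltNge => /negP; apply.
        have -> : y = (y - pi / 2) + pi / 2 by rewrite subrK.
        rewrite cosDpihalf oppr_le0 sin_ge0_pi //; have := pi_ge0 R.
        by clear -hy ypi; lra.
      have y2 : 0 <= y <= 2 by rewrite y0 (le_trans yp2) // ltW // pihalf_lt2.
      have -> : y ^+ 2 / 9 = (y / 3) ^+ 2 by field.
      by rewrite lerXn2r ?nnegrE ?sin_ge_third ?divr_ge0 ?(le_trans _ (sin_ge_third y2)) ?divr_ge0.
    have [th0|th0] := leP 0 th.
      by apply: hs => //; rewrite -(ger0_norm th0).
    have := hs (- th); rewrite oppr_ge0 (ltW th0) -(ltr0_norm th0) hth ltr0_norm //.
    by rewrite cosN sinN !sqrrN; apply.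
  have -> : 1 - th ^+ 2 / (36 * t ^+ 2 + th ^+ 2) = 36 * t ^+ 2 / (36 * t ^+ 2 + th ^+ 2).
    by field; rewrite gt_eqF.
  rewrite ler_pdivrMr // mulrAC ler_pdivlMr // /D.
  have h1 : w ^+ 2 <= 4 * t ^+ 2.
    have -> : 4 * t ^+ 2 = (2 * t) ^+ 2 by ring.
    by rewrite lerXn2r ?nnegrE ?mulr_ge0.
  have h2 : sin th ^+ 2 <= 4 * r ^+ 2 * sin th ^+ 2.
    rewrite ler_peMl ?sqr_ge0 //; have -> : 4 * r ^+ 2 = (2 * r) ^+ 2 by ring.
    by rewrite expr_ge1 //; clear -rh; lra.
  have h3 : w ^+ 2 * th ^+ 2 <= 4 * t ^+ 2 * th ^+ 2 by rewrite ler_wpM2r ?sqr_ge0.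
  have h4 : 36 * t ^+ 2 * (th ^+ 2 / 9) <= 36 * t ^+ 2 * (4 * r ^+ 2 * sin th ^+ 2).
    by rewrite ler_wpM2l ?mulr_ge0 ?sqr_ge0 // (le_trans s3).
  by clear -h3 h4; lra.
have -> : r * w * cos th / D = r / w * (cos th * (w ^+ 2 / D)).
  by field; rewrite !gt_eqF.
have cw : cos th * (w ^+ 2 / D) <= 1 - th ^+ 2 / (36 * t ^+ 2 + th ^+ 2).
  apply: (le_trans _ fr); apply: ler_piMl; last exact: cos_le1.
  by rewrite divr_ge0 ?sqr_ge0 // ltW.
have -> (x y : R) : x - x * y = x * (1 - y) by ring.
apply: ler_pM => //.
  by rewrite invr_ge0 mulr_ge0.
by clear -cw; lra.
Qed.

Lemma exists_wave_dominated : exists2 C : R, 0 < C & forall N t v th,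
  0 < t <= 1 / 2 -> 2 <= N%:R * t ^+ 2 -> `|th| <= pi ->
  `|wave N t v th| <= C / (1 + th ^+ 2 / t ^+ 3).
Proof.
have [K KE] : exists K : R, K = 296 by exists 296.
have K0 : 0 < K by rewrite KE ltr0n.
have K1 : 1 <= K by rewrite KE ler1n.
exists (expR 1 * (K + 17 * (6 * K ^+ 3))).
  by rewrite mulr_gt0 ?expR_gt0 // addr_gt0 // mulr_gt0 // mulr_gt0 // exprn_gt0.
move=> N t v th ht hN hth; have /andP[t0 t1] := ht.
apply: (le_trans (wave_bound N v th (ltW t0))).
have h1 := osc_sum_ge ht hN hth.
set q := th ^+ 2; have q0 : 0 <= q by rewrite sqr_ge0.
rewrite -/q in h1.
set S := \sum_(j < N) _ in h1 *.
set E := q / (4 * t * (36 * t ^+ 2 + q)) in h1.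
apply: (@le_trans _ _ (expR 1 * expR (- (E / 2)))).
  by rewrite -expRD ler_expR; clear -h1; lra.
rewrite -mulrA ler_pM2l ?expR_gt0 //.
have t20 : 0 < t ^+ 2 by rewrite exprn_gt0.
have t30 : 0 < t ^+ 3 by rewrite exprn_gt0.
have den : 0 < 36 * t ^+ 2 + q by rewrite ltr_wpDr // mulr_gt0.
set u := q / t ^+ 3; have u0 : 0 <= u by rewrite divr_ge0 // ltW.
have u1 : 0 < 1 + u by rewrite ltr_wpDr.
have KK : 0 <= 17 * (6 * K ^+ 3) by rewrite mulr_ge0 // mulr_ge0 // exprn_ge0 // ltW.
have [qt|qt] := leP q (t ^+ 2).
  have hE : u / K <= E / 2.
    have -> : E / 2 = u * (t ^+ 2 / (8 * (36 * t ^+ 2 + q))).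
      by rewrite /E /u; field; rewrite !gt_eqF.
    rewrite ler_wpM2l // ler_pdivlMr ?mulr_gt0 // mulrC ler_pdivrMr //.
    by rewrite KE; clear -qt; lra.
  apply: (@le_trans _ _ (expR (- (u / K)))); first by rewrite ler_expR lerN2.
  apply: (@le_trans _ _ (1 + u / K)^-1).
    by rewrite expRN lef_pV2 ?posrE ?expR_gt0 ?expR_ge1Dx // ltr_wpDr // divr_ge0 // ltW.
  have -> : (1 + u / K)^-1 = K / (K + u) by field; rewrite !gt_eqF // ltr_wpDr.
  apply: (@le_trans _ _ (K / (1 + u))).
    by rewrite ler_pM2l // lef_pV2 ?posrE ?ltr_wpDr // lerD2r.
  by rewrite ler_pM2r ?invr_gt0 // lerDl.
have hE : (K * t)^-1 <= E / 2.
  rewrite /E -[leLHS]div1r ler_pdivrMr ?mulr_gt0 //.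
  have -> : q / (4 * t * (36 * t ^+ 2 + q)) / 2 * (K * t) = q * K / (8 * (36 * t ^+ 2 + q)).
    by field; rewrite !gt_eqF.
  rewrite ler_pdivlMr ?mulr_gt0 // mul1r.
  by rewrite KE; clear -qt; lra.
have Kt : 0 < K * t by rewrite mulr_gt0.
apply: (@le_trans _ _ (expR (- (K * t)^-1))); first by rewrite ler_expR lerN2.
apply: (@le_trans _ _ (6 * (K * t) ^+ 3)).
  rewrite expRN -[leRHS]invrK lef_pV2 ?posrE ?expR_gt0 ?invr_gt0 ?mulr_gt0 ?exprn_gt0 //.
  have /= := @expR_ge1Dxn R (K * t)^-1 2; rewrite invr_ge0 (ltW Kt) => /(_ isT).
  rewrite (_ : 3`!%:R = 6 :> R) // exprVn invfM mulrC => h; clear -h; lra.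
apply: (@le_trans _ _ (17 * (6 * K ^+ 3) / (1 + u))); last first.
  by rewrite ler_pM2r ?invr_gt0 // lerDr ltW.
rewrite ler_pdivlMr // exprMn.
have q16 : q <= 16.
  have : `|th| ^+ 2 <= 4 ^+ 2.
    rewrite lerXn2r ?nnegrE //; apply: (le_trans hth).
    by have := pihalf_lt2 R; move: (pi : R) => p; clear; lra.
  by rewrite real_normK ?num_real // -/q => h; clear -h; lra.
have -> : 6 * (K ^+ 3 * t ^+ 3) * (1 + u) = (6 * K ^+ 3) * (t ^+ 3 + q).
  by rewrite /u; field; rewrite gt_eqF.
rewrite [leRHS]mulrC ler_wpM2l; [by []| |].
  by rewrite mulr_ge0 // exprn_ge0 // ltW.
have : t ^+ 3 <= 1 by rewrite exprn_ile1 ?ltW //; clear -t1; lra.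
by clear -q16; lra.
Qed.

End domination.


(** * Fourier inversion and the local limit theorem *)

Section integrals.
Variable R : realType.
Notation mu := (@lebesgue_measure R).
Local Open Scope classical_set_scope.

Lemma integrable_oneDsqrV (C : R) :
  mu.-integrable setT (fun u => (C * (oneDsqr u)^-1)%:E).
Proof.
apply: (@integrableZl _ _ _ mu setT measurableT C (fun u => ((oneDsqr u)^-1)%:E)).
have mf : measurable_fun setT (fun u : R => (oneDsqr u)^-1).
  by apply: continuous_measurable_fun; exact: continuous_oneDsqrV.
apply/integrableP; split; first exact/measurable_EFinP.
under eq_integral do rewrite /= ger0_norm ?invr_ge0 ?(le_trans ler01 (oneDsqr_ge1 _)) //.
rewrite (@ge0_symfun_integralT R (fun u => (oneDsqr u)^-1)).
- rewrite -set_itvcy integral0y_oneDsqr -EFinM; exact: ltry.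
- by move=> u; rewrite invr_ge0 (le_trans ler01 (oneDsqr_ge1 _)).
- exact: continuous_oneDsqrV.
- by move=> u; rewrite /= /oneDsqr sqrrN.
Qed.

Lemma integral_gaussian (a : R) : 0 < a ->
  (\int[mu]_u (expR (- (a * u ^+ 2)))%:E = (Num.sqrt (pi / a))%:E)%E.
Proof.
move=> a0; pose s := Num.sqrt (1 / (2 * a)).
have s2 : s ^+ 2 = 1 / (2 * a) by rewrite sqr_sqrtr // divr_ge0 // mulr_ge0 // ltW.
have s0 : s != 0 by rewrite gt_eqF // sqrtr_gt0 divr_gt0 // mulr_gt0.
have peak0 := normal_peak_gt0 s0.
have peakE : (normal_peak s)^-1 = Num.sqrt (pi / a).
  rewrite /normal_peak invrK s2 -mulr_natr; congr Num.sqrt.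
  by move: (pi : R) => p; field; rewrite gt_eqF.
have pdfE u : normal_pdf 0 s u = normal_peak s * expR (- (a * u ^+ 2)).
  rewrite normal_pdfE // /normal_fun subr0 s2; congr (_ * expR _).
  by rewrite -mulr_natr; field; rewrite gt_eqF.
have e u : expR (- (a * u ^+ 2)) = (normal_peak s)^-1 * normal_pdf 0 s u.
  by rewrite pdfE mulKf // gt_eqF.
under eq_integral do rewrite e EFinM.
rewrite integralZl //; last exact: integrable_normal_pdf.
by rewrite integral_normal_pdf mule1 peakE.
Qed.

Lemma sinMn_pi k : sin (k%:R * pi) = 0 :> R.
Proof.
elim: k => [|k IH]; first by rewrite mul0r sin0.
by rewrite -natr1 mulrDl mul1r sinDpi IH oppr0.
Qed.

Lemma integral_cos_sum (w : nat -> R) (m n : nat) (l : R) : 0 < l -> (n < m)%N ->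
  (\int[mu]_(u in `[(- (pi / l))%R, (pi / l)%R]) (\sum_(k < m) w k * cos ((k%:R - n%:R) *
    (l * u)))%:E
   = (w n * (2 * pi / l))%:E)%E.
Proof.
move=> l0 nm.
pose F (k : nat) (u : R) := if k == n then w k * u else
  w k / ((k%:R - n%:R) * l) * sin ((k%:R - n%:R) * l * u).
have dF k (u : R) : is_derive u 1 (F k) (w k * cos ((k%:R - n%:R) * (l * u))).
  rewrite /F; case: eqVneq => [->|kn].
    rewrite subrr mul0r cos0; apply: is_derive_eq.
    by rewrite /GRing.scale /= !mulr1.
  have kn0 : (k%:R - n%:R) * l != 0 :> R.
    by apply: mulf_neq0; [rewrite subr_eq0 eqr_nat | rewrite gt_eqF].
  apply: is_derive_eq.
  rewrite /GRing.scale /= !mulr1 [in RHS](mulrA (k%:R - n%:R)).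
  by move: ((k%:R - n%:R) * l) kn0 => c c0; field.
pose G u := \sum_(k < m) F k u.
have dG (u : R) : is_derive u 1 G (\sum_(k < m) w k * cos ((k%:R - n%:R) * (l * u))).
  have -> : G = \sum_(k < m) F k by apply/funext => z; rewrite fct_sumE.
  by apply: is_derive_sum.
have cg : continuous (fun u : R => \sum_(k < m) w k * cos ((k%:R - n%:R) * (l * u))).
  move=> u; apply: differentiable_continuous; rewrite -derivable1_diffP.
  have -> : (fun u : R => \sum_(k < m) w k * cos ((k%:R - n%:R) * (l * u))) =
    \sum_(k < m) (fun u : R => w k * cos ((k%:R - n%:R) * (l * u))).
    by apply/funext => z; rewrite fct_sumE.
  apply: derivable_sum => k; apply: ex_derive.
have cG : continuous G.
  move=> u; apply: differentiable_continuous; rewrite -derivable1_diffP.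
  by apply: ex_derive; exact: dG.
have B0 : 0 < pi / l by rewrite divr_gt0 ?pi_gt0.
rewrite (@continuous_FTC2 R (fun u => \sum_(k < m) w k * cos ((k%:R - n%:R) * (l * u))) G).
- rewrite -EFinB; congr EFin; rewrite /G -sumrB (bigD1 (Ordinal nm)) //= big1 ?addr0.
    by rewrite /F eqxx; field; rewrite gt_eqF.
  move=> k /eqP kn; rewrite /F; case: eqVneq => [e|kn'].
    by case: kn; apply: val_inj.
  rewrite mulrN sinN.
  have -> : (k%:R - n%:R) * l * (pi / l) = (k%:R - n%:R) * pi :> R.
    by move: (pi : R) => p; field; rewrite gt_eqF.
  suff -> : sin ((k%:R - n%:R) * pi) = 0 :> R.
    by rewrite !(oppr0, mulr0, subr0).
  have [kn2|kn2] := leqP n k; first by rewrite -natrB // sinMn_pi.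
  by rewrite -opprB mulNr sinN -natrB ?sinMn_pi ?oppr0 // ltnW.
- by rewrite gtrN.
- exact: continuous_subspaceT.
- split; first by move=> u _; apply: ex_derive; exact: dG.
  + by apply: cvg_at_right_filter; exact: cG.
  + by apply: cvg_at_left_filter; exact: cG.
- by move=> u _; rewrite derive1E; apply: derive_val; exact: dG.
Qed.

End integrals.


Section saddle_point.
Variable R : realType.
Notation mu := (@lebesgue_measure R).
Implicit Types (n : nat) (u : R).

Definition eta2 : R := pi ^+ 2 / 12.
(* The fourth root makes the saddle point t = sqrt (eta2 / n) and the scale
   t^(3/2) polynomial. *)
Definition root4 n : R := Num.sqrt (Num.sqrt (eta2 / n%:R)).
Definition saddle n : R := root4 n ^+ 2.
Definition window n : R := root4 n ^+ 3.
Definition pair_coef n : R := (pair_poly R (8 * n))`_n.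

Lemma eta2_gt0 : 0 < eta2.
Proof. by rewrite divr_gt0 // exprn_gt0 // pi_gt0. Qed.

Lemma eta2_lt : eta2 < 4 / 3.
Proof.
rewrite /eta2; have := pihalf_lt2 R; have := pi_gt0 R; move: (pi : R) => p.
by nra.
Qed.

Lemma root4_gt0 n : (0 < n)%N -> 0 < root4 n.
Proof. by move=> n0; rewrite !sqrtr_gt0 divr_gt0 ?eta2_gt0 ?ltr0n. Qed.

Lemma root4X n : root4 n ^+ 4 = eta2 / n%:R.
Proof.
rewrite (exprM _ 2 2) !sqr_sqrtr ?sqrtr_ge0 //.
by rewrite divr_ge0 // ltW // eta2_gt0.
Qed.

Lemma saddle_sqr n : (0 < n)%N -> n%:R * saddle n ^+ 2 = eta2.
Proof.
by move=> n0; rewrite /saddle -exprM root4X mulrCA divff ?mulr1 // pnatr_eq0 -lt0n.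
Qed.

Lemma root4_le n : (22 <= n)%N -> root4 n <= 1 / 2.
Proof.
move=> n22; rewrite -(@ler_pXn2r _ 4) ?nnegrE ?sqrtr_ge0 ?divr_ge0 // root4X.
have n0 : 0 < n%:R :> R by rewrite ltr0n (leq_trans _ n22).
rewrite ler_pdivrMr //.
have : 22%:R <= n%:R :> R by rewrite ler_nat.
have := eta2_lt; have -> : (1 / 2) ^+ 4 = 1 / 16 :> R by field.
lra.
Qed.

Lemma expRN_lipschitz (x y : R) : 0 <= x -> 0 <= y ->
  `|expR (- x) - expR (- y)| <= `|x - y|.
Proof.
wlog xy : x y / x <= y.
  move=> h x0 y0; have [/h H|/ltW/h H] := leP x y; first exact: H.
  by rewrite distrC [leRHS]distrC; exact: H.
move=> x0 y0; rewrite ger0_norm; last by rewrite subr_ge0 ler_expR lerN2.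
rewrite distrC (ger0_norm (_ : 0 <= y - x)) ?subr_ge0 //.
have -> : expR (- x) - expR (- y) = expR (- x) * (1 - expR (- (y - x))).
  by rewrite mulrBr mulr1 -expRD; congr (_ - expR _); ring.
have h := expR_ge1Dx (- (y - x)).
apply: (@le_trans _ _ (1 * (1 - expR (- (y - x))))).
  apply: ler_wpM2r; last by rewrite -expR0 ler_expR oppr_le0.
  by rewrite subr_ge0 -expR0 ler_expR oppr_le0 subr_ge0.
lra.
Qed.

Lemma root4_cvg0 : (root4 n @[n --> \oo] --> (0 : R))%classic.
Proof.
apply/cvgr0Pnorm_lt => e e0; near=> n.
have n0 : 0 < n%:R :> R by near: n; exact: nbhs_infty_gtr.
rewrite ger0_norm ?sqrtr_ge0 // -(@ltr_pXn2r _ 4) ?nnegrE ?sqrtr_ge0 ?(ltW e0) //.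
rewrite root4X ltr_pdivrMr // mulrC -ltr_pdivrMr ?exprn_gt0 //.
by near: n; exact: nbhs_infty_gtr.
Unshelve. all: by end_near. Qed.

Lemma saddle_facts n : (22 <= n)%N ->
  [/\ 0 < saddle n <= 1 / 4, n%:R * saddle n ^+ 2 = eta2,
      n%:R * saddle n = eta2 / saddle n &
      2 <= (8 * n)%:R * saddle n ^+ 2].
Proof.
move=> n22; have n0 : (0 < n)%N by apply: leq_trans n22.
have r0 := root4_gt0 n0; have r1 := root4_le n22.
have t0 : 0 < saddle n by rewrite exprn_gt0.
have tn := saddle_sqr n0.
split => //.
- rewrite t0 /= /saddle (_ : 1 / 4 = (1 / 2) ^+ 2); last by field.
  by rewrite lerXn2r ?nnegrE ?(ltW r0) // divr_ge0.
- by rewrite -tn expr2 mulrA mulfK // gt_eqF.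
- have := pi_sqr_bounds R; rewrite -/eta2 => /andP[A1 _].
  by rewrite natrM -mulrA tn; lra.
Qed.

Lemma wave_gauss_limit : exists K : R -> R, forall n u, (22 <= n)%N ->
  `|wave (8 * n) (saddle n) n%:R (window n * u) - expR (- (eta2 * u ^+ 2))| <=
  root4 n * K u.
Proof.
exists (fun u => 782 * `|u| + 192 * `|u| ^+ 3 + 1536 * `|u| ^+ 4 + 608 * u ^+ 2).
move=> n u n22; have n0 : (0 < n)%N by apply: leq_trans n22.
have s0 := root4_gt0 n0; have s12 := root4_le n22.
set s := root4 n in s0 s12 *.
have t0 : 0 < saddle n by rewrite /saddle exprn_gt0.
have t14 : saddle n <= 1 / 4.
  rewrite /saddle -/s (_ : 1 / 4 = (1 / 2) ^+ 2); last by field.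
  by rewrite lerXn2r ?nnegrE //; lra.
have tn := saddle_sqr n0.
have A13 := pi_sqr_bounds R; rewrite -/eta2 in A13; have /andP[A1 A2] := A13.
have N2 : 2 <= (8 * n)%:R * saddle n ^+ 2 by rewrite natrM -mulrA tn; lra.
apply: (le_trans (ler_distD (expR (- (varZ (8 * n) (saddle n) * (window n * u) ^+ 2 / 2))) _ _)).
have b1 : 0 < saddle n <= 1 by clear -t0 t14; lra.
have b2 : 0 < saddle n <= 1 / 2 by clear -t0 t14; lra.
have b3 : 1 <= 2 * (8 * n)%:R * saddle n ^+ 2 by clear -N2; lra.
have hM : `|meanZ (8 * n) (saddle n) - n%:R| <= 391 / s ^+ 2.
  have := meanZ_bound b1 b3; rewrite -/eta2.
  have -> : eta2 / saddle n ^+ 2 = n%:R by rewrite -tn mulfK // expf_neq0 // gt_eqF.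
  done.
have hV : `|varZ (8 * n) (saddle n) * saddle n ^+ 3 - 2 * eta2| <= 1216 * s.
  have se : 0 < s <= 1 / 2 by rewrite s0.
  have := varZ_bound b2 se N2; rewrite -/eta2.
  have -> : saddle n / s = s by rewrite /saddle -/s expr2 mulfK // gt_eqF.
  by move=> h; apply: (le_trans h); rewrite -mulrDl; apply: ler_wpM2r; [exact: ltW|lra].
have q0 : 0 <= u ^+ 2 by rewrite sqr_ge0.
have gauss2 : `|expR (- (varZ (8 * n) (saddle n) * (window n * u) ^+ 2 / 2)) -
    expR (- (eta2 * u ^+ 2))| <= 608 * s * u ^+ 2.
  have -> : varZ (8 * n) (saddle n) * (window n * u) ^+ 2 / 2 =
     (varZ (8 * n) (saddle n) * saddle n ^+ 3) * u ^+ 2 / 2.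
    by rewrite /window /saddle -/s; field.
  have V0 : 0 <= varZ (8 * n) (saddle n) * saddle n ^+ 3.
    apply: mulr_ge0; last by rewrite exprn_ge0 // ltW.
    rewrite /varZ; apply: mulr_ge0 => //; apply: sumr_ge0 => j _.
    have /andP[f0 f1] := fermi01 (j.*2.+1%:R * saddle n).
    by apply: mulr_ge0; rewrite ?sqr_ge0 // mulr_ge0 // subr_ge0.
  apply: (le_trans (expRN_lipschitz _ _)).
  - by rewrite divr_ge0 // mulr_ge0.
  - by rewrite mulr_ge0 // ltW // eta2_gt0.
  have -> (x a q : R) : x * q / 2 - a * q = (x - 2 * a) * q / 2 by field.
  rewrite normrM normrM (ger0_norm q0) (ger0_norm (_ : 0 <= 2^-1)) //.
  have := ler_wpM2r q0 hV; clear; lra.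
have h1 : `|(meanZ (8 * n) (saddle n) - n%:R) * (window n * u)| <= 391 * s * `|u|.
  rewrite normrM; apply: (le_trans (ler_wpM2r (normr_ge0 _) hM)).
  rewrite normrM (ger0_norm (_ : 0 <= window n)); last by rewrite exprn_ge0 // ltW.
  by rewrite /window -/s mulrA; apply: ler_wpM2r => //; rewrite le_eqVlt; apply/orP; left;
    apply/eqP; field; rewrite gt_eqF.
have wE : window n = s ^+ 3 by [].
have w0 : 0 <= window n by rewrite wE exprn_ge0 // ltW.
have h2 k : \sum_(j < 8 * n) expR (- (j.*2.+1%:R * saddle n)) * `|j.*2.+1%:R *
  (window n * u)| ^+ k.+1
   <= k.+1`!%:R * (2 / saddle n) ^+ k.+2 * (s ^+ 3 * `|u|) ^+ k.+1.
  have := sum_expRN_moment_le k (8 * n) t0 => h.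
  apply: (le_trans _ (ler_wpM2r _ h)); last by rewrite exprn_ge0 // mulr_ge0 // exprn_ge0 // ltW.
  rewrite mulr_suml le_eqVlt; apply/orP; left; apply/eqP; apply: eq_bigr => j _.
  rewrite normrM normrM (ger0_norm w0) normr_nat exprMn wE; ring.
have h3 := h2 2; have h4 := h2 3.
have e3 : 3`!%:R * (2 / saddle n) ^+ 4 * (s ^+ 3 * `|u|) ^+ 3 = 96 * s * `|u| ^+ 3.
  rewrite (_ : 3`!%:R = 6 :> R) // /saddle -/s.
  by move: (`|u|) => v; field; rewrite gt_eqF.
have e4 : 4`!%:R * (2 / saddle n) ^+ 5 * (s ^+ 3 * `|u|) ^+ 4 = 768 * s ^+ 2 * `|u| ^+ 4.
  rewrite (_ : 4`!%:R = 24 :> R) // /saddle -/s.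
  by move: (`|u|) => v; field; rewrite gt_eqF.
rewrite e3 in h3; rewrite e4 in h4.
have hG := wave_gauss (8 * n) n%:R (window n * u) (ltW t0).
have ss : s ^+ 2 <= s by rewrite expr2 ler_piMl ?(ltW s0) //; clear -s12; lra.
have h5 : s ^+ 2 * `|u| ^+ 4 <= s * `|u| ^+ 4 by rewrite ler_wpM2r ?exprn_ge0.
apply: (@le_trans _ _ (2 * (391 * s * `|u|) + 2 * (96 * s * `|u| ^+ 3 + 768 * s ^+ 2 * `|u| ^+ 4)
   + 608 * s * u ^+ 2)).
  apply: lerD => //; apply: (le_trans hG); apply: lerD; first by rewrite ler_pM2l.
  rewrite ler_pM2l //; under eq_bigr do rewrite mulrDr.
  by rewrite big_split /=; apply: lerD.
by clear -h5; lra.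
Qed.

End saddle_point.


Section pair_coefficients.
Variable R : realType.
Notation mu := (@lebesgue_measure R).
Implicit Types (n : nat) (u : R).
Local Open Scope classical_set_scope.

Let half_width n : R := pi / window R n.
Let peak n u := wave (8 * n) (saddle R n) n%:R (window R n * u).
Let peak_cut n := peak n \_ `[- half_width n, half_width n].

Definition scaled_coef n : R := pair_coef R n * expR (- (n%:R * saddle R n)) *
  expR (- logZ (8 * n) (saddle R n)) * (2 * pi / window R n).

Let m n := maxn (size (pair_poly R (8 * n))) n.+1.
Let w n k := (pair_poly R (8 * n))`_k * expR (- (k%:R * saddle R n)) *
  expR (- logZ (8 * n) (saddle R n)).

Lemma window_gt0 n : (0 < n)%N -> 0 < window R n.
Proof. by move=> n0; rewrite exprn_gt0 // root4_gt0. Qed.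

Let peakE n u : peak n u =
  \sum_(k < m n) w n k * cos ((k%:R - n%:R) * (window R n * u)).
Proof.
have := @wave_sum R (8 * n) (m n) (saddle R n) n%:R (window R n * u) (leq_maxl _ _).
move=> h; rewrite -[LHS](mulKf (_ : expR (logZ (8 * n) (saddle R n)) != 0)) ?gt_eqF ?expR_gt0 //.
rewrite -/(wave _ _ _ _) -h mulr_sumr -expRN; apply: eq_bigr => k _.
by rewrite /w; ring.
Qed.

Let peak_continuous n : continuous (peak n).
Proof.
have -> : peak n = fun u => \sum_(k < m n) w n k * cos ((k%:R - n%:R) * (window R n * u)).
  by apply/funext => u; rewrite peakE.
move=> u; apply: differentiable_continuous; rewrite -derivable1_diffP.
have -> : (fun u : R => \sum_(k < m n) w n k * cos ((k%:R - n%:R) * (window R n * u))) =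
  \sum_(k < m n) (fun u : R => w n k * cos ((k%:R - n%:R) * (window R n * u))).
  by apply/funext => z; rewrite fct_sumE.
by apply: derivable_sum => k; apply: ex_derive.
Qed.

Let measurable_peak_cut n : measurable_fun setT (peak_cut n).
Proof.
apply/(measurable_restrictT _ (measurable_itv _)).
by apply: measurable_funTS; apply: continuous_measurable_fun; exact: peak_continuous.
Qed.

Let integral_peak_cut n : (0 < n)%N ->
  (\int[mu]_u (peak_cut n u)%:E = (scaled_coef n)%:E)%E.
Proof.
move=> n0; have := @integral_cos_sum R (w n) (m n) n _ (window_gt0 n0) (leq_maxr _ _).
rewrite /scaled_coef -/(pair_coef R n) => <-.
rewrite [in RHS]integral_mkcond; apply: eq_integral => u _.
rewrite -/(half_width n) /peak_cut /patch; case: ifP => // _.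
by rewrite peakE.
Qed.

Let window_sqr n : window R n ^+ 2 = saddle R n ^+ 3.
Proof. by rewrite /window /saddle -!exprM. Qed.

Lemma scaled_coef_cvg : scaled_coef n @[n --> \oo] --> Num.sqrt (pi / eta2 R).
Proof.
rewrite -(cvg_shiftn 22) /=.
have [C C0 dom] := exists_wave_dominated R; have [K hK] := wave_gauss_limit R.
have n22 n : (22 <= n + 22)%N by rewrite leq_addl.
have n0 n : (0 < n + 22)%N by rewrite addnS.
have [] := @dominated_convergence _ _ R mu setT measurableT
  (fun n u => (peak_cut (n + 22) u)%:E) (fun u => (expR (- (eta2 R * u ^+ 2)))%:E)
  (fun u => (C * (oneDsqr u)^-1)%:E).
- by move=> n; apply/measurable_EFinP; exact: measurable_peak_cut.
- apply/measurable_EFinP; apply: measurableT_comp => //.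
  apply: measurableT_comp => //; apply: measurable_funM => //.
- apply: aeW => u _; apply: cvg_EFin; first exact: nearW.
  have lim0 : root4 R (n + 22) * K u @[n --> \oo] --> (0 : R).
    rewrite -(mul0r (K u)); apply: cvgMr_tmp.
    by have := @root4_cvg0 R; rewrite -(cvg_shiftn 22).
  have winB : \forall n \near \oo, `|u| <= half_width (n + 22).
    have : root4 R (n + 22) * (1 + `|u|) @[n --> \oo] --> (0 : R).
      rewrite -(mul0r (1 + `|u|)); apply: cvgMr_tmp.
      by have := @root4_cvg0 R; rewrite -(cvg_shiftn 22).
    move/cvgr0Pnorm_lt => /(_ 1 ltr01); apply: filterS => n.
    have r0 := root4_gt0 R (n0 n); have r1 := root4_le R (n22 n).
    rewrite ger0_norm; last by rewrite mulr_ge0 ?addr_ge0 // ltW.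
    move=> h; rewrite /half_width ler_pdivlMr ?window_gt0 //.
    have wr : window R (n + 22) <= root4 R (n + 22).
      rewrite /window exprS ler_piMr ?(ltW r0) // exprn_ile1 ?(ltW r0) //.
      by lra.
    have : `|u| * window R (n + 22) <= `|u| * root4 R (n + 22) by rewrite ler_wpM2l.
    have := pi_ge2 R; lra.
  apply/cvgrPdist_lt => e e0.
  have lt0 := (cvgr0Pnorm_lt _).1 lim0 e e0.
  near=> n; have hB : `|u| <= half_width (n + 22) by near: n; exact: winB.
  rewrite /= /peak_cut /patch mem_set /=; last first.
    by rewrite in_itv /= -ler_norml.
  rewrite distrC; apply: (le_lt_trans (hK _ _ (n22 n))).
  by apply: (le_lt_trans (ler_norm _)); near: n; exact: lt0.
- exact: integrable_oneDsqrV.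
- apply: aeW => u n _; rewrite /= lee_fin /peak_cut /patch.
  case: ifPn => [|_]; last first.
    by rewrite normr0 mulr_ge0 ?(ltW C0) // invr_ge0 (le_trans ler01 (oneDsqr_ge1 _)).
  rewrite inE /= in_itv /= -ler_norml => hu.
  have [/andP[t0 t1] _ _ N2] := saddle_facts R (n22 n).
  have t12 : 0 < saddle R (n + 22) <= 1 / 2 by rewrite t0; lra.
  have w0 := window_gt0 (n0 n).
  have hth : `|window R (n + 22) * u| <= pi.
    by rewrite normrM (gtr0_norm w0) mulrC -ler_pdivlMr.
  apply: (le_trans (dom _ _ (n + 22)%:R _ t12 N2 hth)).
  rewrite exprMn window_sqr mulrAC divff ?mul1r // expf_neq0 // gt_eqF //.
move=> _ _; rewrite integral_gaussian ?eta2_gt0 // => h.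
have /fine_cvg := h.
apply: cvg_trans; apply: near_eq_cvg; apply: nearW => n /=.
by rewrite integral_peak_cut.
Unshelve. all: by end_near. Qed.

End pair_coefficients.


(** * Ties are negligible *)

Section tied_pairs.
Variable R : realType.
Implicit Types (n N m : nat) (r t e : R).

Lemma pair_horner_S r m : (pair_poly R m.+1).[r] =
  (pair_poly R m).[r] * (1 + r ^+ m.*2.+1) ^+ 2.
Proof. by rewrite /pair_poly odd_prodS exprMn hornerM !horner_exp hornerD hornerXn hornerC. Qed.

Lemma pair_horner_gt0 r m : 0 < r -> 0 < (pair_poly R m).[r].
Proof.
move=> r0; elim: m => [|m IH].
  by rewrite /pair_poly /odd_prod big_ord0 expr1n hornerC.
by rewrite pair_horner_S mulr_gt0 // exprn_gt0 // addr_gt0 // exprn_gt0.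
Qed.

Lemma pair_horner_exp N t : (pair_poly R N).[expR (- t)] = expR (logZ N t).
Proof.
elim: N => [|N IH].
  by rewrite /pair_poly /odd_prod /logZ !big_ord0 expr1n hornerC mulr0 expR0.
rewrite pair_horner_S IH /logZ big_ord_recr /= mulrDr expRD; congr (_ * _).
by rewrite expRM_natl -expR_soft -expRM_natl mulrN.
Qed.

Lemma tied_horner_S r m : (tied_poly R m.+1).[r] =
  (tied_poly R m).[r] + (r ^+ m.*2.+1) ^+ 2 * (pair_poly R m).[r].
Proof. by rewrite /tied_poly big_ord_recr /= hornerD hornerM horner_exp hornerXn. Qed.

Lemma tied_horner_le r m d : 0 < r <= 1 ->
  2 * (tied_poly R (m + d)).[r] <=
  (pair_poly R m).[r] + r ^+ m.*2.+1 * (pair_poly R (m + d)).[r].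
Proof.
move=> /andP[r0 r1].
have x0 k : 0 <= r ^+ k by rewrite exprn_ge0 ?(ltW r0).
have x1 k : r ^+ k <= 1 by rewrite exprn_ile1 ?(ltW r0).
have P0 k := ltW (pair_horner_gt0 k r0).
have start k : 2 * (tied_poly R k).[r] <= (pair_poly R k).[r].
  elim: k => [|k IH]; first by rewrite /tied_poly big_ord0 hornerC mulr0.
  rewrite tied_horner_S pair_horner_S; have := x1 k.*2.+1; have := x0 k.*2.+1.
  move: (r ^+ _) ((pair_poly R k).[r]) (P0 k) IH => x P P0' IH h0 h1.
  have : 0 <= x * P by rewrite mulr_ge0.
  have : x * (x * P) <= 1 * (x * P) by rewrite ler_wpM2r // mulr_ge0.
  lra.
elim: d => [|d IH].
  rewrite addn0; apply: (le_trans (start m)).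
  by rewrite lerDl mulr_ge0.
rewrite addnS tied_horner_S pair_horner_S.
have y0 := x0 m.*2.+1; have z0 := x0 (m + d).*2.+1.
have zy : r ^+ (m + d).*2.+1 <= r ^+ m.*2.+1 by rewrite ler_wiXn2l ?(ltW r0) //; lia.
move: (r ^+ (m + d).*2.+1) (r ^+ m.*2.+1) ((pair_poly R (m + d)).[r]) (P0 (m + d)%N) IH y0 z0 zy.
move=> x y P P0' IH y0 z0 zy.
have : x * (x * P) <= y * (x * P) by rewrite ler_wpM2r // mulr_ge0.
have : 0 <= y * (x ^+ 2 * P) by rewrite mulr_ge0 // mulr_ge0 // sqr_ge0.
lra.
Qed.

Lemma pair_horner_tail r m d : 0 < r ->
  (pair_poly R m).[r] * (1 + \sum_(j < d) r ^+ (m + j).*2.+1) ^+ 2 <=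
  (pair_poly R (m + d)).[r].
Proof.
move=> r0; elim: d => [|d IH].
  by rewrite big_ord0 addr0 expr1n mulr1 addn0.
rewrite big_ord_recr /= addnS pair_horner_S.
apply: (le_trans _ (ler_wpM2r (sqr_ge0 _) IH)).
rewrite -mulrA -exprMn; apply: ler_wpM2l; first exact/ltW/pair_horner_gt0.
set S := \sum_(j < d) _; have S0 : 0 <= S.
  by apply: sumr_ge0 => j _; rewrite exprn_ge0 // ltW.
have x0 : 0 <= r ^+ (m + d).*2.+1 by rewrite exprn_ge0 // ltW.
rewrite lerXn2r ?nnegrE ?mulr_ge0 ?addr_ge0 //.
have : 0 <= S * r ^+ (m + d).*2.+1 by rewrite mulr_ge0.
lra.
Qed.

(* Split the ties at the index m where r ^+ (2 m) crosses e. *)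
Lemma tied_horner_small N t e : 0 < t <= 1 / 2 -> t ^+ 2 <= e < 1 -> 2 <= N%:R * t ^+ 2 ->
  (tied_poly R N).[expR (- t)] <= (pair_poly R N).[expR (- t)] * (32 * (t / e) ^+ 2 + e).
Proof.
move=> /andP[t0 t1] /andP[te e1] hN.
have t20 : 0 < t ^+ 2 by rewrite exprn_gt0.
have e0 : 0 < e := lt_le_trans t20 te.
set r := expR (- t); have r0 : 0 < r by rewrite expR_gt0.
have r1 : r <= 1 by rewrite -expR0 ler_expR oppr_le0 ltW.
have er k : expR (- (k%:R * t)) = r ^+ k by rewrite /r -expRM_natl mulrN.
have rh : 1 / 2 <= r by have := expR_ge1Dx (- t); rewrite -/r; lra.
pose m := Num.truncn (- ln e / (2 * t)).
have le0 : 0 <= - ln e / (2 * t).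
  by rewrite divr_ge0 ?mulr_ge0 ?(ltW t0) // oppr_ge0 ln_le0 // ltW.
have /andP[m1 m2] := truncn_itv le0.
have tt : 0 < 2 * t by rewrite mulr_gt0.
have rm : e <= r ^+ m.*2.
  rewrite -er -[leLHS](lnK (_ : e \is Num.pos)) ?posrE // ler_expR.
  move: m1; rewrite ler_pdivlMr // -/m -mul2n natrM.
  by move: (m%:R : R) (ln e) => x y; clear; lra.
have rm1 : r ^+ m.+1.*2 < e.
  rewrite -er -[ltRHS](lnK (_ : e \is Num.pos)) ?posrE // ltr_expR.
  move: m2; rewrite ltr_pdivrMr // -/m -mul2n natrM -natr1.
  by move: (m%:R : R) (ln e) => x y; clear; lra.
clear le0 m1 m2; clearbody m.
have y1 : r ^+ m.*2.+1 <= 2 * e.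
  have : r * r ^+ m.*2.+1 <= e by rewrite -exprS -doubleS ltW.
  have : 1 / 2 * r ^+ m.*2.+1 <= r * r ^+ m.*2.+1 by rewrite ler_wpM2r // exprn_ge0 // ltW.
  lra.
have y2 : e / 2 <= r ^+ m.*2.+1.
  rewrite exprS; apply: (@le_trans _ _ (1 / 2 * r ^+ m.*2)); first lra.
  by rewrite ler_wpM2r // exprn_ge0 // ltW.
have rN : r ^+ N.*2 <= t ^+ 2 / 8.
  by rewrite -er expRN_double_le.
have mN : (m <= N)%N.
  rewrite leqNgt; apply/negP => Nm.
  have : r ^+ m.*2 <= r ^+ N.*2.
    by apply: ler_wiXn2l; rewrite ?(ltW r0) // leq_double ltnW.
  lra.
have rN1 : r ^+ N.*2.+1 <= e / 4.
  rewrite exprS; apply: (@le_trans _ _ (1 * r ^+ N.*2)); last lra.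
  by rewrite ler_wpM2r // exprn_ge0 // ltW.
have NE : N = (m + (N - m))%N by rewrite subnKC.
have h1 := @tied_horner_le r m (N - m) (_ : 0 < r <= 1).
have h2 := @pair_horner_tail r m (N - m) r0; have h3 := sum_geometric_odd r m (N - m).
rewrite -NE in h1 h2 h3; have {}h1 := h1 ltac:(by rewrite r0).
set S := \sum_(j < N - m) _ in h2 h3.
have P0 := pair_horner_gt0 m r0; have PN := pair_horner_gt0 N r0.
have w2 : 1 - r ^+ 2 <= 2 * t.
  by have := expR_ge1Dx (- (2%:R * t)); rewrite er; lra.
have S0 : 0 <= S by apply: sumr_ge0 => j _; rewrite exprn_ge0 // ltW.
have S1 : e / (8 * t) <= S.
  rewrite ler_pdivrMr ?mulr_gt0 //.
  have : (1 - r ^+ 2) * S <= 2 * t * S by rewrite ler_wpM2r.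
  lra.
have S2 : (e / (8 * t)) ^+ 2 <= (1 + S) ^+ 2.
  rewrite lerXn2r ?nnegrE ?addr_ge0 //; last lra.
  by rewrite divr_ge0 ?mulr_ge0 // ltW.
have h4 : (pair_poly R m).[r] <= 64 * (t / e) ^+ 2 * (pair_poly R N).[r].
  have : (pair_poly R m).[r] * (e / (8 * t)) ^+ 2 <= (pair_poly R N).[r].
    by apply: le_trans h2; rewrite ler_pM2l.
  have -> : 64 * (t / e) ^+ 2 = ((e / (8 * t)) ^+ 2)^-1 by field; rewrite !gt_eqF.
  by rewrite -ler_pdivlMr ?exprn_gt0 ?divr_gt0 ?mulr_gt0 // [in X in _ -> X]mulrC.
have h5 : r ^+ m.*2.+1 * (pair_poly R N).[r] <= 2 * e * (pair_poly R N).[r].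
  by rewrite ler_pM2r.
have -> (P q : R) : P * (32 * q + e) = (64 * q * P + 2 * e * P) / 2 by field.
rewrite ler_pdivlMr // mulrC; apply: (le_trans h1); exact: lerD.
Qed.

End tied_pairs.


(** * Comparison with the main term *)

Section asymptotics.
Variable R : realType.
Implicit Types n : nat.
Local Open Scope classical_set_scope.

Definition tied_coef n : R := (tied_poly R (8 * n))`_n.
(* Ties are split where q^(2m) = [slack n] * sqrt t; any o(1) slack with
   sqrt t = o(slack^2) would do. *)
Definition slack n : R := Num.sqrt (Num.sqrt (root4 R n)).
Definition growth n : R := expR (2 * (n%:R * saddle R n)) * window R n.

Lemma slack_cvg0 : slack n @[n --> \oo] --> (0 : R).
Proof.
have sc := @sqrt_continuous R.
have h : Num.sqrt (root4 R n) @[n --> \oo] --> (0 : R).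
  by rewrite -(sqrtr0 R); apply: continuous_cvg; [exact: sc|exact: root4_cvg0].
by rewrite -(sqrtr0 R); apply: continuous_cvg; [exact: sc|exact: h].
Qed.

Lemma slackX n : slack n ^+ 4 = root4 R n.
Proof. by rewrite (exprM _ 2 2) !sqr_sqrtr ?sqrtr_ge0. Qed.

Lemma exists_tied_coef_le : exists2 K : R, 0 < K & forall n, (22 <= n)%N ->
  0 <= tied_coef n <= K * slack n * growth n.
Proof.
exists (8 * expR 1 * (33 * expR 65)).
  by rewrite !mulr_gt0 ?expR_gt0.
move=> n n22; have n0 : (0 < n)%N by apply: leq_trans n22.
have [/andP[t0 t1] tn nt N2] := saddle_facts R n22.
have s0 := root4_gt0 R n0; have s1 := root4_le R n22.
have tied0 : 0 <= tied_coef n by have := @tied_poly_ge0 R (8 * n) n; rewrite coef0.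
rewrite tied0 /=.
set t := saddle R n in t0 t1 tn nt N2 *.
have tE : t = root4 R n ^+ 2 by [].
have h0 : 0 < slack n by rewrite /slack 2!sqrtr_gt0.
have h1 : slack n <= 1.
  by rewrite -(@ler_pXn2r _ 4) ?nnegrE ?(ltW h0) // slackX expr1n; lra.
set s := root4 R n in s0 s1 tE *.
set h := slack n in h0 h1 *.
have sh : s = h ^+ 4 by rewrite /h slackX.
pose e := h * s.
have hs : s <= h by rewrite sh exprS ler_piMr ?(ltW h0) // exprn_ile1 // ltW.
have te : t ^+ 2 <= e < 1.
  apply/andP; split.
    rewrite tE -exprM /e; apply: (@le_trans _ _ (s * s)); last by rewrite ler_wpM2r // ltW.
    by rewrite exprS ler_wpM2l ?(ltW s0) // exprS ler_piMr ?(ltW s0) // exprn_ile1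
      ?(ltW s0) //; lra.
  by apply: (@le_lt_trans _ _ s); [rewrite /e ler_piMl // ltW | lra].
pose I := Num.truncn (4 * t)^-1.
have t40 : 0 < 4 * t by rewrite mulr_gt0.
have i1 : 1 <= (4 * t)^-1 by rewrite invf_ge1 //; lra.
have /andP[I1 I2] := truncn_itv (le_trans ler01 i1).
have It : I%:R * (4 * t) <= 1 by rewrite -ler_pdivlMr // div1r.
have I3 : 1 <= I%:R :> R.
  by rewrite ler1n lt0n; apply/eqP => I0; move: I2; rewrite -/I I0; lra.
have I4 : 1 <= 8 * t * I%:R.
  have : 1 < I.+1%:R * (4 * t) by rewrite -ltr_pdivrMr // div1r.
  rewrite -natr1 mulrDl; have : 4 * t <= I%:R * (4 * t) by rewrite ler_peMl // ltW.
  by move: (I%:R : R) => x; clear; lra.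
clear I1 I2 i1; clearbody I.
have NI : 2 <= (8 * n + I)%:R * t ^+ 2.
  apply: (le_trans N2); rewrite natrD; apply: ler_wpM2r; first exact: sqr_ge0.
  by rewrite lerDl.
have t12 : 0 < t <= 1 / 2 by rewrite t0; lra.
have small := tied_horner_small t12 te NI.
have r01 : 0 <= expR (- t) <= 1.
  by rewrite expR_ge0 -[leRHS]expR0 ler_expR oppr_le0 ltW.
have low := @tied_poly_coef_horner R (8 * n) I n _ r01.
have LB : logZ (8 * n + I) t <= eta2 R / t + 65.
  have := @logZ_bound R (8 * n + I) t t0; rewrite -/(eta2 R) => LB.
  have /LB : 1 <= 8 * (8 * n + I)%:R * t ^+ 2 by rewrite -mulrA; move: NI; lra.
  by rewrite ler_norml => /andP[_]; lra.
have pe : expR (- t) ^+ (n + 4 * I) * (expR 1 * expR (n%:R * t)) >= 1.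
  rewrite -expRM_natl -!expRD -[leLHS]expR0 ler_expR natrD natrM.
  by move: It; lra.
have q : (t / e) ^+ 2 = h ^+ 2 * s.
  have -> : t / e = s / h by rewrite tE /e; field; rewrite !gt_eqF.
  by rewrite sh; move: h0; move: (h) => h'; move=> ?; field; rewrite gt_eqF.
have b1 : (pair_poly R (8 * n + I)).[expR (- t)] * (32 * (t / e) ^+ 2 + e) <=
   expR 65 * expR (n%:R * t) * (33 * (h * s)).
  rewrite pair_horner_exp; apply: ler_pM; rewrite ?expR_ge0 //.
  - apply: addr_ge0; first by apply: mulr_ge0; [|exact: sqr_ge0].
    by rewrite /e mulr_ge0 // ltW.
  - by rewrite -expRD ler_expR nt addrC.
  rewrite q /e; have : h ^+ 2 * s <= h * s.
    by rewrite expr2 ler_wpM2r ?(ltW s0) // ler_piMl // ltW.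
  by clear; lra.
have low2 : tied_coef n * expR (- t) ^+ (n + 4 * I) * I%:R <=
   expR 65 * expR (n%:R * t) * (33 * (h * s)).
  by rewrite mulr_natr; apply: (le_trans low); apply: (le_trans small).
have c1 : tied_coef n <= tied_coef n *
    (expR (- t) ^+ (n + 4 * I) * (expR 1 * expR (n%:R * t)) * (8 * t * I%:R)).
  rewrite ler_peMr //; apply: (@le_trans _ _ (1 * 1)); first by rewrite mulr1.
  by apply: ler_pM.
apply: (le_trans c1).
have -> : tied_coef n * (expR (- t) ^+ (n + 4 * I) * (expR 1 * expR (n%:R * t)) * (8 * t * I%:R)) =
   (8 * t * expR 1 * expR (n%:R * t)) * (tied_coef n * expR (- t) ^+ (n + 4 * I) * I%:R) by ring.
apply: (@le_trans _ _ (8 * t * expR 1 * expR (n%:R * t) * (expR 65 * expR (n%:R * t) *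
  (33 * (h * s))))).
  by apply: ler_wpM2l => //; rewrite !mulr_ge0 ?expR_ge0 // ltW.
rewrite le_eqVlt; apply/orP; left; apply/eqP.
rewrite /growth /window -/s -/t.
have -> : expR (2 * (n%:R * t)) = expR (n%:R * t) * expR (n%:R * t).
  by rewrite -expRD; congr expR; ring.
rewrite {1}tE; ring.
Qed.

Lemma powR_X4 (a x : R) (k : nat) : 0 <= a -> x * 4 = k%:R -> (a `^ x) ^+ 4 = a ^+ k.
Proof. by move=> a0 xk; rewrite -powR_mulrn ?powR_ge0 // -powRrM xk powR_mulrn. Qed.

Definition denominator n : R := 2 `^ (5 / 2) * 3 `^ (1 / 4) * n%:R `^ (3 / 4).

Lemma window_denominator n : (0 < n)%N ->
  window R n * denominator n = 4 * pi / Num.sqrt (pi / eta2 R).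
Proof.
move=> n0; have p0 := pi_gt0 R; have A0 := eta2_gt0 R.
have n0' : 0 < n%:R :> R by rewrite ltr0n.
have l0 : 0 <= window R n * denominator n.
  by rewrite mulr_ge0 ?(ltW (window_gt0 R n0)) // !mulr_ge0 ?powR_ge0.
have r0 : 0 <= 4 * pi / Num.sqrt (pi / eta2 R).
  by rewrite divr_ge0 ?sqrtr_ge0 // mulr_ge0 // ltW.
apply/eqP; rewrite -(@eqrXn2 _ 4) //; apply/eqP.
rewrite /denominator expr_div_n !exprMn.
rewrite (@powR_X4 2 _ 10) ?(@powR_X4 3 _ 1) ?(@powR_X4 n%:R _ 3) //; try by field.
rewrite (_ : Num.sqrt (pi / eta2 R) ^+ 4 = (pi / eta2 R) ^+ 2); last first.
  by rewrite (exprM _ 2 2) sqr_sqrtr // divr_ge0 // ltW.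
rewrite root4X /eta2.
have pn : (pi : R) != 0 by rewrite gt_eqF.
have nn : (n%:R : R) != 0 by rewrite gt_eqF.
move: (n%:R : R) nn (pi : R) pn => x x0 p p1.
by field; rewrite x0 p1.
Qed.

Lemma exponentE n : (0 < n)%N -> pi * Num.sqrt (n%:R / 3) = 2 * (n%:R * saddle R n).
Proof.
move=> n0; have p0 := pi_gt0 R.
have r0 : 0 <= 2 * (n%:R * saddle R n) by rewrite mulr_ge0 // mulr_ge0 // sqr_ge0.
have l0 : 0 <= pi * Num.sqrt (n%:R / 3 : R) by rewrite mulr_ge0 ?sqrtr_ge0 // ltW.
apply/eqP; rewrite -(@eqrXn2 _ 2) //; apply/eqP.
rewrite exprMn sqr_sqrtr ?divr_ge0 //.
have -> : (2 * (n%:R * saddle R n)) ^+ 2 = 4 * n%:R * (n%:R * saddle R n ^+ 2) by ring.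
by rewrite saddle_sqr // /eta2; move: (pi : R) => p; field.
Qed.

Definition profile n : R := expR (pi * Num.sqrt (n%:R / 3)) / denominator n.

Lemma profile_growth n : (0 < n)%N ->
  profile n = growth n / (4 * pi / Num.sqrt (pi / eta2 R)).
Proof.
move=> n0; have w0 : window R n != 0 by rewrite gt_eqF // window_gt0.
have D0 : denominator n != 0.
  by rewrite !mulf_neq0 // gt_eqF // powR_gt0 // ltr0n.
rewrite -(window_denominator n0) /profile /growth exponentE //.
by move: (expR _) => x; field; rewrite w0 D0.
Qed.

Let sigma : R := Num.sqrt (pi / eta2 R).

Let sigma_gt0 : 0 < sigma.
Proof. by rewrite sqrtr_gt0 divr_gt0 ?pi_gt0 ?eta2_gt0. Qed.

Lemma pair_coef_profile n : (0 < n)%N ->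
  pair_coef R n / profile n =
  scaled_coef R n * expR (logZ (8 * n) (saddle R n) - n%:R * saddle R n) * (2 / sigma).
Proof.
move=> n0; rewrite profile_growth // /scaled_coef /growth -/sigma.
set x := n%:R * saddle R n; set y := logZ _ _.
have -> : expR (y - x) = expR y / expR x by rewrite expRD expRN.
have -> : expR (2 * x) = expR x * expR x by rewrite -expRD; congr expR; ring.
rewrite !expRN; have w0 := window_gt0 R n0.
have := expR_gt0 x; have := expR_gt0 y; move: (expR x) (expR y) (window R n) w0 => a b w w0 b0 a0.
have := pi_gt0 R; have := sigma_gt0; move: sigma (pi : R) => s p s0 p0.
by field; rewrite !gt_eqF.
Qed.

Lemma logZ_saddle_cvg :
  expR (logZ (8 * n) (saddle R n) - n%:R * saddle R n) @[n --> \oo] --> (1 : R).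
Proof.
suff h0 : logZ (8 * n) (saddle R n) - n%:R * saddle R n @[n --> \oo] --> (0 : R).
  by have := cvg_comp _ _ h0 (@continuous_expR R 0); rewrite expR0.
have h : root4 R n * 65 @[n --> \oo] --> (0 : R).
  by rewrite -(mul0r (65 : R)); apply: cvgMr_tmp; exact: root4_cvg0.
apply/cvgr0Pnorm_lt => e e0; have he := (cvgr0Pnorm_lt _).1 h e e0.
near=> n; have n22 : (22 <= n)%N by near: n; exact: nbhs_infty_ge.
have [/andP[t0 t1] tn nt N2] := saddle_facts R n22.
have n0 : (0 < n)%N by apply: leq_trans n22.
have r0 := root4_gt0 R n0; have r1 := root4_le R n22.
rewrite nt; apply: (@le_lt_trans _ _ (root4 R n * 65)); last first.
  by apply: (le_lt_trans (ler_norm _)); near: n; exact: he.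
have := @logZ_bound R (8 * n) (saddle R n) t0; rewrite -/(eta2 R) => LB.
have /LB H : 1 <= 8 * (8 * n)%:R * saddle R n ^+ 2 by rewrite -mulrA; move: N2; lra.
apply: (le_trans H); rewrite [leRHS]mulrC ler_wpM2l //.
by rewrite /saddle expr2 ler_piMl ?(ltW r0) //; move: r1; lra.
Unshelve. all: by end_near. Qed.

Lemma pair_coef_cvg : pair_coef R n / profile n @[n --> \oo] --> (2 : R).
Proof.
have -> : (2 : R) = sigma * 1 * (2 / sigma) by field; rewrite gt_eqF.
have h : scaled_coef R n * expR (logZ (8 * n) (saddle R n) - n%:R * saddle R n) * (2 / sigma)
    @[n --> \oo] --> sigma * 1 * (2 / sigma).
  apply: cvgMr_tmp; apply: cvgM; [exact: scaled_coef_cvg | exact: logZ_saddle_cvg].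
apply: cvg_trans h; apply: near_eq_cvg; near=> n.
rewrite pair_coef_profile //; near: n; exact: nbhs_infty_gt.
Unshelve. all: by end_near. Qed.

Lemma tied_coef_cvg : tied_coef n / profile n @[n --> \oo] --> (0 : R).
Proof.
have [K K0 hK] := exists_tied_coef_le.
have h : slack n * (K * (4 * pi / sigma)) @[n --> \oo] --> (0 : R).
  by rewrite -(mul0r (K * (4 * pi / sigma))); apply: cvgMr_tmp; exact: slack_cvg0.
apply/cvgr0Pnorm_lt => e e0; have he := (cvgr0Pnorm_lt _).1 h e e0.
near=> n; have n22 : (22 <= n)%N by near: n; exact: nbhs_infty_ge.
have n0 : (0 < n)%N by apply: leq_trans n22.
have /andP[a0 a1] := hK n n22.
have g0 : 0 < growth n by rewrite mulr_gt0 ?expR_gt0 // window_gt0.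
have k0 : 0 < 4 * pi / sigma by rewrite divr_gt0 // mulr_gt0 ?pi_gt0.
rewrite profile_growth // -/sigma ger0_norm; last first.
  by apply: divr_ge0 => //; apply: divr_ge0; exact: ltW.
apply: (@le_lt_trans _ _ (slack n * (K * (4 * pi / sigma)))); last first.
  by apply: (le_lt_trans (ler_norm _)); near: n; exact: he.
have gk : 0 < growth n / (4 * pi / sigma) by exact: divr_gt0.
rewrite (ler_pdivrMr _ _ gk); apply: (le_trans a1).
rewrite le_eqVlt; apply/orP; left; apply/eqP.
by move: (4 * pi / sigma) k0 => k k0; field; rewrite gt_eqF.
Unshelve. all: by end_near. Qed.

Lemma pair_coef_split n : (0 < n)%N -> pair_coef R n = 2 * (ou_star n)%:R + tied_coef n.
Proof.
move=> n0; rewrite (@ou_star_coef R n (8 * n)); last by rewrite leq_pmull.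
rewrite /pair_coef pair_poly_split 2!coefD coefMn coef1 gtn_eqF // add0r.
by rewrite mulr_natl.
Qed.

End asymptotics.

Theorem theorem1p4 (R : realType) :
  asymptotic_equiv
    (fun n : nat => (ou_star n)%:R : R)
    (fun n : nat => expR (pi * Num.sqrt (n%:R / 3))
       / (2 `^ (5 / 2) * 3 `^ (1 / 4) * n%:R `^ (3 / 4))).
Proof.
have h : ((pair_coef R n / profile R n - tied_coef R n / profile R n) / 2
    @[n --> \oo] --> ((2 - 0) / 2 : R))%classic.
  by apply: cvgMr_tmp; apply: cvgB; [exact: pair_coef_cvg | exact: tied_coef_cvg].
rewrite subr0 divff // in h.
apply: cvg_trans h; apply: near_eq_cvg; near=> n.
have n0 : (0 < n)%N by near: n; exact: nbhs_infty_gt.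
by rewrite -mulrBl pair_coef_split // addrK mulrAC [2 * _]mulrC mulfK.
Unshelve. all: by end_near. Qed.
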